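(* Let $H\in(\frac12,\frac34)$ and assume $\mathbb E[\phi_i^4]<\infty$. Let $\widehat\phi_i:=\widehat\theta_i+\frac12\widehat\sigma^2$. Then: 1. As $n,N\to\infty$ sequentially, $\widehat\phi_i$ is strongly consistent: for each fixed $i=1,\dots,N$, $\widehat\phi_i\xrightarrow{\text{a.s.}}\phi_i$. 2. As $n,N\to\infty$ sequentially, $$\sqrt N(\widehat\phi_i-\phi_i)\xrightarrow{d}\mathcal N\Big(0,\frac14v_\sigma^2\Big),$$ where $v_\sigma^2$ is the asymptotic variance of $\widehat\sigma^2$ (the variance of the centered normal limit in distribution of $\sqrt N(\widehat\sigma^2-\sigma^2)$ as $n,N\to\infty$ sequentially).
   Context: Model. Fix $\sigma>0$, $\gamma>0$, a Hurst index $H$ and a time step $h>0$. For $i=1,2,\dots$ let $B^i$ be standard Brownian motions and $B^{H,i}$ fractional Brownian motions with Hurst index $H$ (centered Gaussian, covariance $\frac12(t^{2H}+s^{2H}-|t-s|^{2H})$), all mutually independent, and set $M^{H,i}_t=\sigma B^i_t+\gamma B^{H,i}_t$. The random effects $\phi_1,\phi_2,\dots$ are i.i.d. real random variables, independent of the family $\{M^{H,i}\}$. Put $\theta_i=\phi_i-\frac{\sigma^2}{2}$ and $Y^i_t=\theta_it+M^{H,i}_t$ (so $X^i_t=e^{Y^i_t}$ solves $dX^i_t=\phi_iX^i_t\,dt+X^i_t\,dM^{H,i}_t$, $X^i_0=1$). Statistics. $\Delta Y^i_k:=Y^i_{(k+1)h}-Y^i_{kh}$, $\widehat\theta_i=\frac1{nh}\sum_{k=0}^{n-1}\Delta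 Y^i_k$, and $\xi^i_n=\frac1n\sum_{k=0}^{n-1}(\Delta Y^i_k)^2$, $\eta^i_n=\frac1n\sum_{k=0}^{n-1}\Delta Y^i_k\Delta Y^i_{k+1}$, $\zeta^i_n=\frac1n\sum_{k=0}^{n-1}(Y^i_{(k+2)h}-Y^i_{kh})(Y^i_{(k+4)h}-Y^i_{(k+2)h})$. Averages over $N$ subjects: $\bar V_{n,N}=\frac1N\sum_{i=1}^N\widehat\theta_i^2$, $\bar\xi_{n,N}=\frac1N\sum_{i=1}^N\xi^i_n$, $\bar\eta_{n,N}=\frac1N\sum_{i=1}^N\eta^i_n$, $\bar\zeta_{n,N}=\frac1N\sum_{i=1}^N\zeta^i_n$. Estimators. With $\log_2^+(x):=\mathbf 1_{\{x>0\}}\log_2x$, $\widehat H=\frac12\log_2^+\!\Big(\frac{\bar\zeta_{n,N}-4h^2\bar V_{n,N}}{\bar\eta_{n,N}-h^2\bar V_{n,N}}\Big)$, $\ \widehat\gamma^2=\frac{\bar\eta_{n,N}-h^2\bar V_{n,N}}{h^{2\widehat H}(2^{2\widehat H-1}-1)}$, $\ \widehat\sigma^2=\frac{\bar\xi_{n,N}-h^2\bar V_{n,N}-\widehat\gamma^2h^{2\widehat H}}{h}$. Asymptotic variance $v_\sigma^2$. In the paper it is the last diagonal entry of the asymptotic covariance matrix of $\sqrt N\big((\widehat H,\widehat\gamma^2,\widehat\sigma^2)-(H,\gamma^2,\sigma^2)\big)$, i.e. $v_\sigma^2=r\,\Sigma\,r^\top$, where $\Sigma=\mathrm{Var}(\theta_1^2)\mathcal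 H\mathcal H^\top$, $\mathcal H=(1,h^2,h^2,4h^2)^\top$, and $r$ is the row vector of partial derivatives of $\widehat\sigma^2$ with respect to $(\bar V_{n,N},\bar\xi_{n,N},\bar\eta_{n,N},\bar\zeta_{n,N})$, evaluated at $(V_\infty,\xi_\infty,\eta_\infty,\zeta_\infty)$ with $V_\infty=\mathbb E[\theta_1^2]$, $\xi_\infty=\mathbb E[\theta_1^2]h^2+\sigma^2h+\gamma^2h^{2H}$, $\eta_\infty=\mathbb E[\theta_1^2]h^2+\gamma^2h^{2H}(2^{2H-1}-1)$, $\zeta_\infty=4\mathbb E[\theta_1^2]h^2+\gamma^2h^{2H}2^{2H}(2^{2H-1}-1)$. Normal laws may be degenerate. ''$n,N\to\infty$ sequentially'' means: first $n\to\infty$ with $N$ fixed, then $N\to\infty$. *)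

(* Defs.v *)
From HB Require Import structures.
From mathcomp Require Import all_boot all_order all_algebra.
From mathcomp Require Import all_classical all_reals all_analysis.

Set Implicit Arguments.
Unset Strict Implicit.
Unset Printing Implicit Defensive.

Import Order.TTheory GRing.Theory Num.Theory.
Import numFieldNormedType.Exports.

Local Open Scope classical_set_scope.
Local Open Scope ring_scope.

(* Normal law with mean m and VARIANCE v >= 0, degenerate case included.
   The case split is needed because [normal_prob m 0] is by convention the
   uniform law on [0, 1], not a Dirac mass. *)
Definition gauss (R : realType) (m v : R) : probability (measurableTypeR R) R :=
  if v == 0 then (@dirac _ (measurableTypeR R) m R : probability _ _)
  else (normal_prob m (Num.sqrt v) : probability _ _).

Section ProbabilityNotions.
Context (R : realType) (d : measure_display) (T : measurableType d).
Variable P : probability T R.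

Definition has_law (X : T -> R) (mu : probability (measurableTypeR R) R) : Prop :=
  forall A : set (measurableTypeR R), measurable A -> P (X @^-1` A) = mu A.

(* sigma-algebra generated by the real random variables X u, u in D *)
Definition sigma_gen (U : Type) (D : set U) (X : U -> T -> R) : set (set T) :=
  <<s \bigcup_(u in D) preimage_set_system [set: T] (X u)
        (@measurable _ (measurableTypeR R)) >>.

(* mutual independence of the classes of events F i : product rule over every
   finite subfamily *)
Definition mutually_independent (I : eqType) (F : I -> set (set T)) : Prop :=
  forall (J : seq I) (A : I -> set T), uniq J ->
    (forall i, i \in J -> F i (A i)) ->
    P (\bigcap_(i in [set` J]) A i) = (\prod_(i <- J) P (A i))%E.

Definition independent2 (F G : set (set T)) : Prop :=
  forall A C, F A -> G C -> P (A `&` C) = (P A * P C)%E.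

Definition iid (phi : nat -> {RV P >-> R}) : Prop :=
  mutually_independent (fun i => sigma_gen [set i] (fun j => phi j : T -> R)) /\
  (forall (i j : nat) (A : set R), measurable A ->
     distribution P (phi i) A = distribution P (phi j) A).

(* All processes are indexed by R but only times t >= 0 are meaningful. *)

Definition standard_brownian (B : R -> {RV P >-> R}) : Prop :=
  [/\ {ae P, forall w, B 0 w = 0},
      forall s t : R, 0 <= s -> s <= t ->
        has_law (fun w => B t w - B s w) (gauss 0 (t - s)),
      forall t : nat -> R, 0 <= t 0%N -> {homo t : m n / (m <= n)%N >-> m <= n} ->
        mutually_independent
          (fun k => sigma_gen [set k] (fun j w => B (t j.+1) w - B (t j) w)) &
      {ae P, forall w, {within `[0, +oo[%classic, continuous (fun t => B t w)}}].

Definition centered_gaussian_process (X : R -> {RV P >-> R}) : Prop :=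
  forall (n : nat) (t c : 'I_n -> R), (forall k, 0 <= t k) ->
    exists2 v : R, 0 <= v &
      has_law (fun w => \sum_(k < n) c k * X (t k) w) (gauss 0 v).

Definition fractional_brownian (H : R) (X : R -> {RV P >-> R}) : Prop :=
  centered_gaussian_process X /\
  (forall s t : R, 0 <= s -> 0 <= t ->
     covariance P (X s) (X t) =
       ((t `^ (2 * H) + s `^ (2 * H) - `|t - s| `^ (2 * H)) / 2)%:E).

(* Sequential limits: first n --> oo with N fixed, then N --> oo. Only sample
   sizes N >= N0 are considered (N0 = i.+1 for a statistic of subject i). *)

Definition seq_cvg_as (N0 : nat) (X : nat -> nat -> T -> R) (L : T -> R) : Prop :=
  exists Xoo : nat -> T -> R,
    (forall N, (N0 <= N)%N ->
       {ae P, forall w, X n N w @[n --> \oo] --> Xoo N w}) /\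
    {ae P, forall w, Xoo N w @[N --> \oo] --> L w}.

Definition bounded_continuous (f : R -> R) : Prop :=
  continuous f /\ exists C : R, forall x, `|f x| <= C.

Definition seq_cvg_law (N0 : nat) (X : nat -> nat -> T -> R)
    (mu : probability (measurableTypeR R) R) : Prop :=
  exists muoo : nat -> probability (measurableTypeR R) R,
    (forall N, (N0 <= N)%N -> forall f : R -> R, bounded_continuous f ->
       (\int[P]_w (f (X n N w))%:E @[n --> \oo] -->
          \int[muoo N]_x (f x)%:E)%E) /\
    (forall f : R -> R, bounded_continuous f ->
       (\int[muoo N]_x (f x)%:E @[N --> \oo] --> \int[mu]_x (f x)%:E)%E).

End ProbabilityNotions.

Section Model.
Context (R : realType) (T : Type).

(* Subjects are numbered from 0. *)

Definition mixed_fbm (sigma gamma : R) (B BH : nat -> R -> T -> R)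
  (i : nat) (t : R) (w : T) : R := sigma * B i t w + gamma * BH i t w.

Definition drift (sigma : R) (phi : nat -> T -> R) (i : nat) (w : T) : R :=
  phi i w - sigma ^+ 2 / 2.

Definition log_process (theta : nat -> T -> R) (M : nat -> R -> T -> R)
  (w : T) (i : nat) (t : R) : R := theta i w * t + M i t w.

End Model.

Section Estimators.
Context (R : realType).
Implicit Types (h V xi eta zeta : R) (n N : nat).

(* Statistics of a single observed path y. *)

Definition incr h (y : R -> R) (k : nat) : R := y (k.+1%:R * h) - y (k%:R * h).

Definition theta_hat h (y : R -> R) n : R :=
  (n%:R * h)^-1 * \sum_(k < n) incr h y k.

Definition xi_stat h (y : R -> R) n : R :=
  n%:R^-1 * \sum_(k < n) incr h y k ^+ 2.

Definition eta_stat h (y : R -> R) n : R :=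
  n%:R^-1 * \sum_(k < n) incr h y k * incr h y k.+1.

Definition zeta_stat h (y : R -> R) n : R :=
  n%:R^-1 * \sum_(k < n)
    (y (k.+2%:R * h) - y (k%:R * h)) * (y (k.+4%:R * h) - y (k.+2%:R * h)).

Definition average N (F : nat -> R) : R := N%:R^-1 * \sum_(i < N) F i.

Definition log2p (x : R) : R := if 0 < x then ln x / ln 2 else 0.

(* The estimators as functions of the four averaged statistics. *)

Definition H_fun h V eta zeta : R :=
  log2p ((zeta - 4 * h ^+ 2 * V) / (eta - h ^+ 2 * V)) / 2.

Definition gamma2_fun h V eta zeta : R :=
  let H := H_fun h V eta zeta in
  (eta - h ^+ 2 * V) / (h `^ (2 * H) * (2 `^ (2 * H - 1) - 1)).

Definition sigma2_fun h V xi eta zeta : R :=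
  (xi - h ^+ 2 * V - gamma2_fun h V eta zeta * h `^ (2 * H_fun h V eta zeta)) / h.

(* y i is the observed path of subject i. *)

Definition sigma2_hat h (y : nat -> R -> R) n N : R :=
  sigma2_fun h (average N (fun i => theta_hat h (y i) n ^+ 2))
               (average N (fun i => xi_stat h (y i) n))
               (average N (fun i => eta_stat h (y i) n))
               (average N (fun i => zeta_stat h (y i) n)).

Definition phi_hat h (y : nat -> R -> R) (i n N : nat) : R :=
  theta_hat h (y i) n + sigma2_hat h y n N / 2.

(* partial derivatives of sigma2_fun with respect to (V, xi, eta, zeta) *)
Definition sigma2_gradient h V xi eta zeta : 'rV[R]_4 :=
  \row_(j < 4) [:: derive1 (fun x => sigma2_fun h x xi eta zeta) V;
                   derive1 (fun x => sigma2_fun h V x eta zeta) xi;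
                   derive1 (fun x => sigma2_fun h V xi x zeta) eta;
                   derive1 (fun x => sigma2_fun h V xi eta x) zeta]`_j.

(* r Sigma r^T with Sigma = varT2 *: Hvec Hvec^T, where mT2 = E[theta^2] and
   varT2 = Var(theta^2). *)
Definition asymptotic_variance_sigma2 (sigma gamma H h mT2 varT2 : R) : R :=
  let V := mT2 in
  let xi := mT2 * h ^+ 2 + sigma ^+ 2 * h + gamma ^+ 2 * h `^ (2 * H) in
  let eta := mT2 * h ^+ 2
             + gamma ^+ 2 * h `^ (2 * H) * (2 `^ (2 * H - 1) - 1) in
  let zeta := 4 * mT2 * h ^+ 2
              + gamma ^+ 2 * h `^ (2 * H) * 2 `^ (2 * H)
                * (2 `^ (2 * H - 1) - 1) in
  let r := sigma2_gradient h V xi eta zeta in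
  let Hvec : 'cV[R]_4 :=
    \col_(j < 4) [:: 1; h ^+ 2; h ^+ 2; 4 * h ^+ 2]`_j in
  let Sigma := varT2 *: (Hvec *m Hvec^T) in
  (r *m Sigma *m r^T) 0 0.

End Estimators.

(* Main.v *)
Require Import Defs.
From HB Require Import structures.
From mathcomp Require Import all_boot all_order all_algebra.
From mathcomp Require Import all_classical all_reals all_analysis.
From mathcomp Require Import measurable_realfun.
From mathcomp Require Import ring lra zify.

(** First let n tend to infinity with N fixed.  The increments of sigma B +
    gamma B^H at the grid points form a stationary Gaussian sequence whose
    covariances are nonnegative, because u |-> sigma^2 u + gamma^2 u^(2H) is
    convex and nondecreasing.  Hence the variance of the sum of the squared
    (shifted) increments is bounded by a constant times the variance of their
    sum, which is O(n^(2H)) = O(n^(3/2)), and a strong law along the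
    subsequence m^4 gives almost sure convergence of all quadratic averages.
    Consequently the three contrasts that enter hat sigma^2 converge almost
    surely, for each fixed N, to their theoretical values, and hat sigma^2 to
    sigma^2: no fluctuation is left when N tends to infinity.  Accordingly the
    variance r Sigma r^T vanishes, and both central limit theorems hold with a
    Dirac mass as limit. *)

Import Order.TTheory GRing.Theory Num.Theory.
Import numFieldNormedType.Exports.

Local Open Scope classical_set_scope.
Local Open Scope ring_scope.

Set Implicit Arguments.
Unset Strict Implicit.
Unset Printing Implicit Defensive.

(** * Integrals of real functions *)

(** Squares carry the argument for two reasons. Their partial sums are nondecreasing, which lets a
    law along a sparse subsequence extend to every n; and the other averages follow from them by
    polarization: means from squares shifted by 0 and 1, products of adjacent increments from
    squares at lags p and 2p. Covariances of squares are quadratic in the covariance r of the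
    increments, but 0 <= r <= v gives r^2 <= v r, and the sum of r over all pairs is the variance of
    a telescoping sum; no decay estimate for r enters. The exponent 4 balances the rates: for n =
    m^4 the bound n^(3/2) is m^6, against the normalization n^2 = m^8, which leaves the summable
    m^(-2), while (m+1)^4 / m^4 still tends to 1. The random drift is added path by path on one
    almost sure event, and it leaves the contrasts because the matching multiple of the averaged
    squared drifts is subtracted. *)

Section HasIntegral.
Context (R : realType) d (T : measurableType d).
Variable mu : {measure set T -> \bar R}.
Implicit Types (X Y : T -> R) (a b : R).

(** Bundling integrability with a real value lets moment identities be assembled as linear
    combinations and closed by [ring] or [field], without separate integrability goals. *)
Definition has_integral X a : Prop :=
  mu.-integrable [set: T] (EFin \o X) /\ (\int[mu]_w (X w)%:E = a%:E)%E.

Lemma has_integral_measurable X a : has_integral X a -> measurable_fun [set: T] X.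
Proof. by move=> [/measurable_int/measurable_EFinP]. Qed.

Lemma eq_has_integral X Y a b : X =1 Y -> a = b -> has_integral X a -> has_integral Y b.
Proof. by move=> /funext <- <-. Qed.

Lemma has_integralD X Y a b : has_integral X a -> has_integral Y b ->
  has_integral (fun w => X w + Y w) (a + b).
Proof.
move=> [iX eX] [iY eY]; split.
  by rewrite (_ : _ \o _ = (EFin \o X) \+ (EFin \o Y))//; exact: integrableD.
under eq_integral do rewrite EFinD.
by rewrite integralD//= eX eY.
Qed.

Lemma has_integralZ c X a : has_integral X a ->
  has_integral (fun w => c * X w) (c * a).
Proof.
move=> [iX eX]; split; first exact: (@integrableZl _ _ _ mu _ measurableT c _ iX).
under eq_integral do rewrite EFinM.
by rewrite integralZl//= eX.
Qed.

Lemma has_integral0 : has_integral (fun=> 0) 0.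
Proof. by split; [exact: integrable0|rewrite integral0]. Qed.

Lemma has_integral_sum (I : Type) (r : seq I) (X : I -> T -> R) (a : I -> R) :
  (forall i, has_integral (X i) (a i)) ->
  has_integral (fun w => \sum_(i <- r) X i w) (\sum_(i <- r) a i).
Proof.
move=> Xa; elim: r => [|i r IH].
  by apply: eq_has_integral has_integral0 => [w|]; rewrite big_nil.
rewrite big_cons; apply: eq_has_integral (has_integralD (Xa i) IH) => // w.
by rewrite big_cons.
Qed.

Lemma has_integral_le X Y a b : has_integral X a -> has_integral Y b ->
  (forall w, X w <= Y w) -> a <= b.
Proof.
move=> [iX eX] [iY eY] XY; rewrite -lee_fin -eX -eY.
by apply: le_integral => // w _; rewrite lee_fin.
Qed.

Lemma has_integral_ge0 X a : has_integral X a -> (forall w, 0 <= X w) -> 0 <= a.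
Proof. by move=> Xa X0; apply: (has_integral_le has_integral0 Xa). Qed.

Lemma has_integral_inj X a b : has_integral X a -> has_integral X b -> a = b.
Proof. by move=> [_ eX] [_]; rewrite eX => -[]. Qed.

Lemma has_integral_dominated X Y b : measurable_fun [set: T] X ->
  has_integral Y b -> (forall w, `|X w| <= Y w) -> exists a, has_integral X a.
Proof.
move=> mX [iY eY] XY; have iX : mu.-integrable [set: T] (EFin \o X).
  apply: (le_integrable measurableT _ _ iY); first exact/measurable_EFinP.
  by move=> w _; rewrite /= lee_fin (le_trans (XY w))// ler_norm.
exists (fine (\int[mu]_w (X w)%:E)%E); split => //.
by rewrite fineK//; exact: integrable_fin_num.
Qed.

End HasIntegral.

Lemma has_integral_cst (R : realType) d (T : measurableType d)
  (P : probability T R) (c : R) : has_integral P (fun=> c) c.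
Proof.
split; first exact: finite_measure_integrable_cst.
by rewrite integral_cst//= probability_setT mule1.
Qed.

(** * Moments of normal laws *)

Section NormalMoments.
Context (R : realType).
Notation mu := (@lebesgue_measure R).

(** The Radon-Nikodym derivative is determined only almost everywhere; it is identified with
    [normal_pdf] because both have the same integral over every measurable set. *)
Lemma ge0_integral_normal_prob (m s : R) (f : R -> \bar R) :
  measurable_fun [set: R] f -> (forall x, (0 <= f x)%E) ->
  (\int[normal_prob m s]_x f x = \int[mu]_x (f x * (normal_pdf m s x)%:E))%E.
Proof.
move=> mf f0.
have dom := normal_prob_dominates m s.
rewrite -(@Radon_Nikodym_SigmaFinite.change_of_variables _ _ _ _ mu dom)//.
have mpdf : measurable_fun [set: R] (fun x => (normal_pdf m s x)%:E).
  by apply/measurable_EFinP; exact: measurable_normal_pdf.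
have iRN := Radon_Nikodym_SigmaFinite.f_integrable dom.
have mRN := measurable_int _ iRN.
apply: ae_eq_integral => //.
- exact: emeasurable_funM.
- exact: emeasurable_funM.
- apply: ae_eqe_mul2l => /=.
  apply: integral_ae_eq => //= E _ mE.
  by rewrite -Radon_Nikodym_SigmaFinite.f_integral.
Qed.

Lemma integrable_normal_prob (m s : R) (f : R -> R) :
  measurable_fun [set: R] f ->
  mu.-integrable [set: R] (fun x => (f x * normal_pdf m s x)%:E) ->
  (normal_prob m s).-integrable [set: R] (EFin \o f).
Proof.
move=> mf /integrableP[_ fi]; apply/integrableP; split.
  exact/measurable_EFinP.
rewrite ge0_integral_normal_prob//; last first.
  by apply: measurableT_comp => //; exact/measurable_EFinP.
rewrite (le_lt_trans _ fi)// le_eqVlt; apply/orP; left; apply/eqP.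
apply: eq_integral => x _ /=.
by rewrite normrM (ger0_norm (normal_pdf_ge0 m s x)) EFinM.
Qed.

Lemma integral_normal_prob (m s : R) (f : R -> R) :
  measurable_fun [set: R] f ->
  mu.-integrable [set: R] (fun x => (f x * normal_pdf m s x)%:E) ->
  (\int[normal_prob m s]_x (f x)%:E
   = \int[mu]_x (f x * normal_pdf m s x)%:E)%E.
Proof.
move=> mf fi; have fI := integrable_normal_prob mf fi.
have dom := normal_prob_dominates m s.
rewrite -(Radon_Nikodym_change_of_variables dom)//=.
have mpdf : measurable_fun [set: R] (fun x => (normal_pdf m s x)%:E).
  by apply/measurable_EFinP; exact: measurable_normal_pdf.
have mf' : measurable_fun [set: R] (fun x => (f x)%:E) by exact/measurable_EFinP.
under [RHS]eq_integral do rewrite EFinM.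
apply: ae_eq_integral => //.
- by apply: emeasurable_funM.
- by apply: emeasurable_funM.
- apply: ae_eqe_mul2l => /=.
  apply: integral_ae_eq => //=; first exact: Radon_Nikodym_integrable.
  by move=> E _ mE; rewrite -Radon_Nikodym_integral.
Qed.

(** Half of the Gaussian exponent absorbs the quartic factor. With y = x^2 / (4 s^2) the exponential
    is e^(-2y); one factor e^(-y) belongs to the density of standard deviation sqrt 2 s, and y^2
    e^(-y) <= 4 because e^(y/2) >= 1 + y/2. As x^4 = 16 s^4 y^2, the constant is 64 = 16 times 4. *)
Lemma normal_pdf_X4_le (s x : R) : 0 < s ->
  x ^+ 4 * normal_pdf 0 s x <=
  64 * s ^+ 4 * (normal_peak s / normal_peak (Num.sqrt 2 * s)) *
    normal_pdf 0 (Num.sqrt 2 * s) x.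
Proof.
move=> s0; have s20 : 0 < Num.sqrt 2 * s by rewrite mulr_gt0// sqrtr_gt0.
rewrite !normal_pdfE ?gt_eqF//.
have pk : 0 < normal_peak s by rewrite normal_peak_gt0// gt_eqF.
have pk2 : 0 < normal_peak (Num.sqrt 2 * s) by rewrite normal_peak_gt0// gt_eqF.
rewrite [leRHS](_ : _ = 64 * s ^+ 4 * normal_peak s * normal_fun 0 (Num.sqrt 2 * s)
  x); last first.
  by field; rewrite gt_eqF.
rewrite /normal_fun !subr0 exprMn sqr_sqrtr//.
set y := x ^+ 2 / (4 * s ^+ 2).
have s2 : 0 < s ^+ 2 by rewrite exprn_gt0.
have -> : - x ^+ 2 / (s ^+ 2 *+ 2) = - y - y.
  by rewrite /y; field; rewrite gt_eqF.
have -> : - x ^+ 2 / ((2 * s ^+ 2) *+ 2) = - y.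
  by rewrite /y; field; rewrite gt_eqF.
have y0 : 0 <= y by rewrite divr_ge0 ?sqr_ge0// mulr_ge0// ltW.
rewrite expRD.
have ey : y ^+ 2 * expR (- y) <= 4.
  have -> : expR (- y) = expR (- (y / 2)) ^+ 2.
    by rewrite -expRM_natr; congr expR; field.
  rewrite expRN -exprMn.
  have h1 := expR_ge1Dx (y / 2).
  have : y * (expR (y / 2))^-1 <= 2.
    by rewrite ler_pdivrMr ?expR_gt0//; lra.
  move=> h2; rewrite (_ : 4 = 2 ^+ 2); last by ring.
  apply: lerXn2r => //; rewrite nnegrE; last by lra.
  by rewrite mulr_ge0// invr_ge0 expR_ge0.
have -> : x ^+ 4 = 16 * s ^+ 4 * y ^+ 2.
  by rewrite /y; field; rewrite gt_eqF.
have c0 : 0 <= 16 * s ^+ 4 * normal_peak s * expR (- y).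
  by rewrite !mulr_ge0 ?expR_ge0 ?exprn_ge0 ?ltW.
have := ler_wpM2l c0 ey.
by congr (_ <= _); ring.
Qed.

(* Integrate over [-n, n] by the fundamental theorem and let n tend to
   infinity by dominated convergence. *)
Lemma integral_derive_eq0 (F f : R -> R) :
  (forall x : R, is_derive x (1 : R) F (f x)) -> continuous f ->
  mu.-integrable [set: R] (EFin \o f) ->
  F n%:R @[n --> \oo] --> 0 -> F (- n%:R) @[n --> \oo] --> 0 ->
  (\int[mu]_x (f x)%:E = 0)%E.
Proof.
move=> dF cf fi Fy FNy.
have mf : measurable_fun [set: R] f by exact: continuous_measurable_fun.
pose fn (n : nat) x : \bar R := (f x * \1_(`[- n.+1%:R, n.+1%:R]%classic) x)%:E.
have mfn n : measurable_fun [set: R] (fn n).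
  by apply/measurable_EFinP/measurable_funM => //; exact: measurable_indic.
have fnE n : (\int[mu]_x fn n x)%E = (F n.+1%:R - F (- n.+1%:R))%:E.
  rewrite EFinB -(@continuous_FTC2 _ f F).
  - rewrite [RHS]integral_mkcond; apply: eq_integral => x _.
    rewrite /fn patchE indicE; case: ifPn => _; first by rewrite mulr1.
    by rewrite mulr0.
  - by rewrite gt0_cp// ltr0n.
  - exact: continuous_subspaceT.
  - have dFx x : derivable F x 1 by have := dF x => -[].
    have cF : continuous F.
      by move=> x; apply: differentiable_continuous; apply/derivable1_diffP.
    split => //.
    + exact/cvg_at_right_filter/cF.
    + exact/cvg_at_left_filter/cF.
  - by move=> x _; rewrite derive1E; apply: derive_val.
have cvg1 : (\int[mu]_x fn n x)%E @[n --> \oo] --> (0 : \bar R)%E.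
  under eq_fun do rewrite fnE.
  apply: cvg_EFin; first by apply: nearW.
  rewrite -[X in _ --> X](subr0 0); apply: cvgB.
  - by rewrite (cvg_shiftS (fun n => F n%:R)).
  - by rewrite (cvg_shiftS (fun n => F (- n%:R))).
have fcv : {ae mu, forall x, setT x -> (fn ^~ x @ \oo --> (EFin \o f) x)}.
  apply: aeW => x _; apply: cvg_EFin; first exact: nearW.
  apply: cvg_near_cst; near=> n.
  rewrite /fn/= indicE mem_set ?mulr1//= in_itv/= -ler_norml.
  by rewrite (@le_trans _ _ n%:R)// ?ler_nat//; near: n; exact: nbhs_infty_ger.
have fub : {ae mu, forall x n, setT x -> (`|fn n x| <= `|f x|%:E)%E}.
  apply: aeW => x n _; rewrite /fn/= lee_fin normrM ler_piMr//.
  by rewrite indicE; case: (_ \in _); rewrite ?normr1 ?normr0.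
have [_ _ cvg2] := @dominated_convergence _ _ _ mu _ measurableT _ _ _ mfn
  (measurable_int mu fi) fcv (integrable_norm fi) fub.
exact: (cvg_unique _ cvg2 cvg1).
Unshelve. all: by end_near. Qed.

Section moments.
Context (s : R) (s0 : 0 < s).
Local Notation pdf := (normal_pdf 0 s).

Let s_neq0 : s != 0. Proof. by rewrite gt_eqF. Qed.

Let pdf_ge0 x : 0 <= pdf x. Proof. exact: normal_pdf_ge0. Qed.

Let mpdf : measurable_fun [set: R] pdf. Proof. exact: measurable_normal_pdf. Qed.

Lemma has_integral_normal_pdf : has_integral mu pdf 1.
Proof. by split; [exact: integrable_normal_pdf|exact: integral_normal_pdf]. Qed.

Lemma has_integral_X4_normal_pdf :
  exists a, has_integral mu (fun x => x ^+ 4 * pdf x) a.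
Proof.
have h : has_integral mu (normal_pdf 0 (Num.sqrt 2 * s)) 1.
  by split; [exact: integrable_normal_pdf|exact: integral_normal_pdf].
apply: has_integral_dominated (has_integralZ _ h) _.
  by apply: measurable_funM => //; exact: measurable_funX.
move=> x; rewrite ger0_norm; first exact: normal_pdf_X4_le.
by rewrite mulr_ge0// (exprM x 2 2) sqr_ge0.
Qed.

Lemma has_integral_Xn_normal_pdf k : (k <= 4)%N ->
  exists a, has_integral mu (fun x => x ^+ k * pdf x) a.
Proof.
move=> k4; have [a ha] := has_integral_X4_normal_pdf.
apply: has_integral_dominated (has_integralD has_integral_normal_pdf ha) _.
  by apply: measurable_funM => //; exact: measurable_funX.
move=> x; rewrite normrM (ger0_norm (pdf_ge0 x)) -[X in X + _]mul1r -mulrDl.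
rewrite ler_wpM2r// normrX.
have -> : x ^+ 4 = `|x| ^+ 4 by rewrite -normrX ger0_norm// (exprM x 2 2) sqr_ge0.
have [x1|x1] := leP `|x| 1.
  by rewrite (le_trans (exprn_ile1 _ _ x1))// lerDl exprn_ge0.
by rewrite (le_trans (ler_weXn2l (ltW x1) k4))// lerDr.
Qed.

Lemma is_derive_normal_pdf (x : R) : is_derive x (1 : R) pdf (- (x / s ^+ 2) * pdf x).
Proof.
have aux (u v : R) : - u / v = - v^-1 * u by rewrite !mulNr mulrC.
rewrite normal_pdfE// /normal_fun.
have -> : (fun x0 : R => normal_peak s * expR (- (x0 - 0) ^+ 2 / (s ^+ 2 *+ 2))) =
  (fun x0 : R => normal_peak s * expR (- (s ^+ 2 *+ 2)^-1 * x0 ^+ 2)).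
  by apply/funext => y; rewrite subr0 aux.
apply: is_derive_eq.
rewrite /GRing.scale/= subr0.
rewrite aux.
set e := expR _.
by field.
Qed.

(** Makes the boundary terms of the integration by parts vanish: |x|^(k+1) <= x^4 when |x| >= 1, and
    x^4 times the density is bounded. *)
Lemma Xn_normal_pdf_bound : exists C, forall k x, (k <= 3)%N -> 1 <= `|x| ->
  `|x ^+ k * pdf x| <= C / `|x|.
Proof.
pose C := 64 * s ^+ 4 * (normal_peak s / normal_peak (Num.sqrt 2 * s)) *
    normal_peak (Num.sqrt 2 * s).
exists C => k x k3 x1; have x0 : 0 < `|x| by rewrite (lt_le_trans _ x1).
rewrite ler_pdivlMr// normrM (ger0_norm (pdf_ge0 x)) normrX mulrAC -exprSr.
have c0 : 0 <= 64 * s ^+ 4 * (normal_peak s / normal_peak (Num.sqrt 2 * s)).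
  by rewrite mulr_ge0 ?divr_ge0 ?normal_peak_ge0// mulr_ge0// exprn_ge0// ltW.
apply: (@le_trans _ _ (x ^+ 4 * pdf x)).
  rewrite ler_wpM2r//.
  have -> : x ^+ 4 = `|x| ^+ 4 by rewrite -normrX ger0_norm// (exprM x 2 2) sqr_ge0.
  exact: ler_weXn2l.
apply: (le_trans (normal_pdf_X4_le _ s0)); rewrite ler_wpM2l//.
by rewrite normal_pdf_ub// mulf_neq0// sqrtr_eq0 -ltNge.
Qed.

(** Stein's identity: the integrand x^(k+1) - s^2 k x^(k-1), weighted by the density, is the
    derivative of - s^2 x^k times the density. For k = 0 the factor [k%:R] kills the meaningless
    [k.-1]. *)
Lemma normal_moment_rec k a b : (k <= 3)%N ->
  has_integral mu (fun x => x ^+ k.+1 * pdf x) a ->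
  has_integral mu (fun x => k%:R * x ^+ k.-1 * pdf x) b ->
  a = s ^+ 2 * b.
Proof.
move=> k3 ha hb.
have h := has_integralD ha (has_integralZ (- s ^+ 2) hb).
have [C hC] := Xn_normal_pdf_bound.
(* A general sequence with |u n| = n covers both endpoints, n and -n. *)
have cvg0 (u : nat -> R) : (forall n, `|u n| = n%:R) ->
    - s ^+ 2 * (u n ^+ k * pdf (u n)) @[n --> \oo] --> 0.
  move=> un; rewrite -[X in _ --> X](mulr0 (- s ^+ 2)); apply: cvgM; first exact:
    cvg_cst.
  apply/norm_cvg0P.
  have C0 : C / n%:R @[n --> \oo] --> (0 : R).
    rewrite -(mulr0 C) -cvg_shiftS; apply: cvgM; first exact: cvg_cst.
    exact: cvg_harmonic.
  apply: (squeeze_cvgr _ (cvg_cst 0) C0).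
  near=> n; rewrite normr_ge0 -(un n) hC// un ler1n; near: n; exact: nbhs_infty_gt.
suff : (\int[mu]_x (x ^+ k.+1 * pdf x + - s ^+ 2 * (k%:R * x ^+ k.-1 * pdf x))%:E =
  0)%E.
  by case: h => _ -> [] /eqP; rewrite mulNr subr_eq0 => /eqP.
apply: (@integral_derive_eq0 (fun x => - s ^+ 2 * (x ^+ k * pdf x))).
- move=> x; have dpdf := is_derive_normal_pdf x.
  have dXk : is_derive x (1 : R) (fun y : R => y ^+ k) (k%:R * x ^+ k.-1).
    have -> : (fun y : R => y ^+ k) = (fun y : R => y) ^+ k.
      by apply/funext => y; rewrite exprfctE.
    by apply: is_derive_eq; rewrite /GRing.scale/= mulr1.
  have dZ := is_deriveZ (- s ^+ 2) (is_deriveM dXk dpdf).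
  apply: (@is_derive_eq _ _ _ _ _ _ _ _ dZ).
  rewrite /GRing.scale/= (exprS x k).
  move: (x ^+ k) (x ^+ k.-1) (pdf x) k%:R => u v p c.
  by field.
- have cpdf : continuous pdf by exact: continuous_normal_pdf.
  move=> x; apply: cvgD.
    by apply: cvgM; [exact: exprn_continuous|exact: cpdf].
  apply: cvgM; first exact: cvg_cst.
  apply: cvgM; last exact: cpdf.
  by apply: cvgM; [exact: cvg_cst|exact: exprn_continuous].
- by case: h.
- by apply: cvg0 => n; rewrite ger0_norm.
- by apply: cvg0 => n; rewrite normrN ger0_norm.
Unshelve. all: by end_near. Qed.

Lemma normal_moments :
  [/\ has_integral mu (fun x => x * pdf x) 0,
      has_integral mu (fun x => x ^+ 2 * pdf x) (s ^+ 2),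
      has_integral mu (fun x => x ^+ 3 * pdf x) 0 &
      has_integral mu (fun x => x ^+ 4 * pdf x) (3 * (s ^+ 2) ^+ 2)].
Proof.
have [a1 h1] := @has_integral_Xn_normal_pdf 1 isT.
have [a2 h2] := @has_integral_Xn_normal_pdf 2 isT.
have [a3 h3] := @has_integral_Xn_normal_pdf 3 isT.
have [a4 h4] := @has_integral_Xn_normal_pdf 4 isT.
have h0 := has_integral_normal_pdf.
have e1 : a1 = 0.
  rewrite (@normal_moment_rec 0 a1 0)// ?mulr0//.
  by apply: eq_has_integral (has_integral0 mu) => // x; rewrite !mul0r.
have e2 : a2 = s ^+ 2.
  rewrite (@normal_moment_rec 1 a2 1)// ?mulr1//.
  by apply: eq_has_integral h0 => // x; rewrite expr0 !mul1r.
have e3 : a3 = s ^+ 2 * (2 * a1).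
  apply: (@normal_moment_rec 2) => //.
  by apply: eq_has_integral (has_integralZ 2 h1) => // x; rewrite mulrA.
have e4 : a4 = s ^+ 2 * (3 * a2).
  apply: (@normal_moment_rec 3) => //.
  by apply: eq_has_integral (has_integralZ 3 h2) => // x; rewrite mulrA.
split.
- by apply: eq_has_integral h1.
- by apply: eq_has_integral h2.
- by apply: eq_has_integral h3 => //; rewrite e3 e1 !mulr0.
- by apply: eq_has_integral h4 => //; rewrite e4 e2; ring.
Qed.

End moments.

End NormalMoments.

(** * Independence *)

Lemma has_integral_transfer (R : realType) d (T : measurableType d)
  d' (T' : measurableType d') (P : {measure set T -> \bar R})
  (m : {measure set T' -> \bar R}) (phi : T -> T') (g : T' -> R) a :
  measurable_fun [set: T] phi ->
  (forall A, measurable A -> P (phi @^-1` A) = m A) ->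
  has_integral m g a -> has_integral P (g \o phi) a.
Proof.
move=> mphi Pm [ig eg].
have mg := measurable_int _ ig.
have eqm (f : T' -> \bar R) :
    (\int[pushforward P phi]_x f x = \int[m]_x f x)%E.
  by apply: eq_measure_integral => A mA _; exact: Pm.
have ig' : P.-integrable [set: T] (EFin \o (g \o phi)).
  move/integrableP : ig => [_ ig]; apply/integrableP; split.
    by apply/measurable_EFinP/measurableT_comp => //; exact/measurable_EFinP.
  rewrite -eqm ge0_integral_pushforward// in ig.
  exact: measurableT_comp.
split => //; rewrite -eg -eqm integral_pushforward//.
Qed.

Section Independence.
Context (R : realType) d (T : measurableType d) (P : probability T R).
Implicit Types X Y : T -> R.

Definition indep X Y : Prop := forall A C : set R, measurable A -> measurable C ->
  P (X @^-1` A `&` Y @^-1` C) = (P (X @^-1` A) * P (Y @^-1` C))%E.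

Lemma indep_comp X Y (f g : R -> R) : measurable_fun [set: R] f ->
  measurable_fun [set: R] g -> indep X Y -> indep (f \o X) (g \o Y).
Proof.
move=> mf mg XY A C mA mC; apply: (XY (f @^-1` A) (g @^-1` C)).
  by rewrite -[X in measurable X]setTI; exact: mf.
by rewrite -[X in measurable X]setTI; exact: mg.
Qed.

(** Independence makes the joint law of [(X, Y)] agree with the product of the marginals on
    rectangles, hence everywhere; Tonelli then gives integrability of the product and Fubini its
    value. *)
Lemma has_integralM X Y a b : indep X Y -> has_integral P X a ->
  has_integral P Y b -> has_integral P (fun w => X w * Y w) (a * b).
Proof.
move=> XY hX hY.
have mX := has_integral_measurable hX; have mY := has_integral_measurable hY.
pose Xm : {RV P >-> R} := mfun_Sub (mem_set mX).
pose Ym : {RV P >-> R} := mfun_Sub (mem_set mY).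
pose dX := distribution P Xm; pose dY := distribution P Ym.
have mXY : measurable_fun [set: T] (fun w => (X w, Y w)).
  exact: measurable_fun_pair.
have mid : measurable_fun [set: R] (@EFin R) by exact/measurable_EFinP.
have hX' : has_integral dX id a.
  split; first by apply: integrable_pushforward => //; case: hX.
  by rewrite integral_distribution; case: hX.
have hY' : has_integral dY id b.
  split; first by apply: integrable_pushforward => //; case: hY.
  by rewrite integral_distribution; case: hY.
suff h : has_integral (dX \x dY)%E (fun z : R * R => z.1 * z.2) (a * b).
  apply: (has_integral_transfer mXY _ h) => A mA.
  pose XYm : {RV P >-> (R * R)%type} := mfun_Sub (mem_set mXY).
  apply/esym/(@product_measure_unique _ _ _ _ _ dX dY (distribution P XYm)) => //.
have mf : measurable_fun [set: R * R] (fun z => (z.1 * z.2)%:E).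
  apply/measurable_EFinP/measurable_funM; first exact: measurable_fst.
  exact: measurable_snd.
have mabs : measurable_fun [set: R] (fun x => `|x|%:E).
  by apply/measurable_EFinP; exact: normr_measurable.
case: hX' => iX eX; case: hY' => iY eY.
have i12 : (dX \x dY)%E.-integrable [set: R * R] (fun z => (z.1 * z.2)%:E).
  apply/(integrable12ltyP _ _ mf) => /=.
  under eq_integral => x _.
    under eq_integral do rewrite normrM EFinM.
    rewrite ge0_integralZl//.
    over.
  move/integrableP : iX => [_ iX]; move/integrableP : iY => [_ iY].
  rewrite ge0_integralZr//; last by apply: integral_ge0.
  by rewrite lte_mul_pinfty ?integral_ge0// ge0_fin_numE// integral_ge0.
split => //.
rewrite -integral12_prod_meas1// /fubini_F/=.
under eq_integral => x _.
  under eq_integral do rewrite EFinM.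
  rewrite integralZl// eY.
  over.
by rewrite integralZr// eX.
Qed.

End Independence.

(** * Moments of Gaussian type up to order four *)

Section GaussMoments.
Context (R : realType) d (T : measurableType d) (P : probability T R).
Implicit Types X Y : T -> R.

(* Gaussianity enters only through these four moments of N(0, v). *)
Definition gauss_moments X (v : R) : Prop :=
  [/\ has_integral P X 0, has_integral P (fun w => X w ^+ 2) v,
      has_integral P (fun w => X w ^+ 3) 0 &
      has_integral P (fun w => X w ^+ 4) (3 * v ^+ 2)].

Lemma eq_gauss_moments X Y v v' : X =1 Y -> v = v' ->
  gauss_moments X v -> gauss_moments Y v'.
Proof. by move=> /funext <- <-. Qed.

Lemma has_law_gauss_moments X v : measurable_fun [set: T] X -> 0 <= v ->
  has_law P X (gauss 0 v) -> gauss_moments X v.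
Proof.
move=> mX v0 lX.
have tr := @has_integral_transfer R _ T _ _ P (gauss 0 v) X _ _ mX lX.
(* [gauss 0 0] is a Dirac mass at 0 and has no density, so its moments are computed separately. *)
have [v_eq0|v_neq0] := eqVneq v 0.
  have h k : has_integral (gauss 0 v) (fun x => x ^+ k.+1) 0.
    rewrite /gauss v_eq0 eqxx.
    have mk : measurable_fun [set: R] (fun x : R => x ^+ k.+1) by exact:
      measurable_funX.
    split; last by rewrite integral_dirac ?expr0n ?diracT ?mul1e//;
      exact/measurable_EFinP.
    apply/integrableP; split; first exact/measurable_EFinP.
    rewrite integral_dirac//; last first.
      by apply: measurableT_comp => //; exact/measurable_EFinP.
    by rewrite diracT mul1e ltry.
  have := tr _ _ (h 0); have := tr _ _ (h 1); have := tr _ _ (h 2); have := tr _ _ (h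
    3).
  by rewrite v_eq0 /gauss_moments expr0n/= mulr0; split.
have s0 : 0 < Num.sqrt v by rewrite sqrtr_gt0 lt_def v_neq0.
have [h1 h2 h3 h4] := normal_moments s0.
have h k a : has_integral lebesgue_measure
    (fun x => x ^+ k.+1 * normal_pdf 0 (Num.sqrt v) x) a ->
    has_integral (gauss 0 v) (fun x => x ^+ k.+1) a.
  have mk : measurable_fun [set: R] (fun x : R => x ^+ k.+1) by exact: measurable_funX.
  rewrite /gauss (negbTE v_neq0) => -[iX eX]; split.
    exact: integrable_normal_prob.
  by rewrite integral_normal_prob.
rewrite sqr_sqrtr// in h2 h4.
split; [exact: (tr _ _ (h 0 _ h1))|exact: (tr _ _ (h 1 _ h2))|
  exact: (tr _ _ (h 2 _ h3))|exact: (tr _ _ (h 3 _ h4))].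
Qed.

Lemma gauss_momentsZ c X v : gauss_moments X v ->
  gauss_moments (fun w => c * X w) (c ^+ 2 * v).
Proof.
move=> [h1 h2 h3 h4]; split.
- by apply: eq_has_integral (has_integralZ c h1) => [w|]; rewrite ?mulr0.
- by apply: eq_has_integral (has_integralZ (c ^+ 2) h2) => // w; ring.
- by apply: eq_has_integral (has_integralZ (c ^+ 3) h3) => [w|]; ring.
- by apply: eq_has_integral (has_integralZ (c ^+ 4) h4) => [w|]; ring.
Qed.

Lemma gauss_momentsD X Y u v : indep P X Y -> gauss_moments X u ->
  gauss_moments Y v -> gauss_moments (fun w => X w + Y w) (u + v).
Proof.
move=> XY [x1 x2 x3 x4] [y1 y2 y3 y4].
have XYij i j a b : has_integral P (fun w => X w ^+ i) a ->
    has_integral P (fun w => Y w ^+ j) b ->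
    has_integral P (fun w => X w ^+ i * Y w ^+ j) (a * b).
  apply: has_integralM.
  by apply: (@indep_comp _ _ _ P X Y (fun x => x ^+ i) (fun x => x ^+ j)) => //;
    exact: measurable_funX.
have x1' : has_integral P (fun w => X w ^+ 1) 0 by [].
have y1' : has_integral P (fun w => Y w ^+ 1) 0 by [].
split.
- by apply: eq_has_integral (has_integralD x1 y1) => //; rewrite addr0.
- apply: eq_has_integral (has_integralD (has_integralD x2 y2)
    (has_integralZ 2 (XYij _ _ _ _ x1' y1'))) => [w|]; ring.
- apply: eq_has_integral (has_integralD (has_integralD x3 y3)
    (has_integralZ 3 (has_integralD (XYij _ _ _ _ x1' y2) (XYij _ _ _ _ x2 y1')))) =>
      [w|]; ring.
- apply: eq_has_integral (has_integralD (has_integralD x4 y4)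
    (has_integralD (has_integralZ 6 (XYij _ _ _ _ x2 y2))
    (has_integralZ 4 (has_integralD (XYij _ _ _ _ x1' y3) (XYij _ _ _ _ x3 y1')))))
      => [w|]; ring.
Qed.

(* Polarization: the joint moments of a pair all of whose linear combinations
   have Gaussian moments. *)
Section pair.
Context (X Y : T -> R) (v r : R).
Hypothesis gX : gauss_moments X v.
Hypothesis gY : gauss_moments Y v.
Hypothesis gD : gauss_moments (fun w => X w + Y w) (2 * v + 2 * r).
Hypothesis gB : gauss_moments (fun w => X w - Y w) (2 * v - 2 * r).

Lemma gauss_moments_XY : has_integral P (fun w => X w * Y w) r.
Proof.
case: gX gY gD => _ X2 _ _ [_ Y2 _ _] [_ D2 _ _].
apply: eq_has_integral (has_integralZ 2^-1
  (has_integralD D2 (has_integralZ (-1) (has_integralD X2 Y2)))) => [w|]; by field.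
Qed.

Lemma gauss_moments_cov_le : `|r| <= v.
Proof.
case: gD gB => _ D2 _ _ [_ B2 _ _].
have D0 := has_integral_ge0 D2 (fun w => sqr_ge0 _).
have B0 := has_integral_ge0 B2 (fun w => sqr_ge0 _).
by rewrite ler_norml; apply/andP; split; lra.
Qed.

(** The mixed moments come from (X+Y)^4 + (X-Y)^4 - 2X^4 - 2Y^4 = 12 X^2 Y^2 and its cubic
    analogues, which yield Isserlis' value v^2 + 2r^2 and vanishing third-order moments. The number
    v + c^2 is the mean of each shifted square. *)
Lemma gauss_moments_cov_sqr c :
  has_integral P (fun w => ((X w + c) ^+ 2 - (v + c ^+ 2)) * ((Y w + c) ^+ 2 - (v + c
    ^+ 2)))
    (2 * r ^+ 2 + 4 * c ^+ 2 * r).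
Proof.
have XY := gauss_moments_XY.
case: gX gY gD gB => X1 X2 X3 X4 [Y1 Y2 Y3 Y4] [_ _ D3 D4] [_ _ B3 B4].
have X2Y2 : has_integral P (fun w => X w ^+ 2 * Y w ^+ 2) (v ^+ 2 + 2 * r ^+ 2).
  apply: eq_has_integral (has_integralZ (12^-1) (has_integralD (has_integralD D4 B4)
    (has_integralZ (-2) (has_integralD X4 Y4)))) => [w|]; by field.
have X2Y : has_integral P (fun w => X w ^+ 2 * Y w) 0.
  apply: eq_has_integral (has_integralZ (6^-1) (has_integralD (has_integralD D3
    (has_integralZ (-1) B3)) (has_integralZ (-2) Y3))) => [w|]; by field.
have XY2 : has_integral P (fun w => X w * Y w ^+ 2) 0.
  apply: eq_has_integral (has_integralZ (6^-1) (has_integralD (has_integralD D3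
    B3) (has_integralZ (-2) X3))) => [w|]; by field.
apply: eq_has_integral (has_integralD X2Y2
  (has_integralD (has_integralZ (2 * c) (has_integralD X2Y XY2))
  (has_integralD (has_integralZ (4 * c ^+ 2) XY)
  (has_integralD (has_integralZ (- v) (has_integralD X2 Y2))
  (has_integralD (has_integralZ (- 2 * c * v) (has_integralD X1 Y1))
  (has_integral_cst P (v ^+ 2))))))) => [w|]; ring.
Qed.

End pair.

End GaussMoments.

(** * Independence of generated sigma-algebras *)

Section GeneratedSigmaAlgebra.
Context (R : realType) d (T : measurableType d) (P : probability T R).

(** Retyping [T] with the generated sigma-algebra makes the ordinary closure lemmas for measurable
    functions available for sub-sigma-algebras. *)
Definition measurable_wrt (G : set (set T)) (X : T -> R) : Prop :=
  @measurable_fun _ _ (g_sigma_algebraType G) R [set: _] X.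

Lemma measurable_wrt_preimage G X (A : set R) : measurable_wrt G X ->
  measurable A -> <<s G >> (X @^-1` A).
Proof. by move=> mX mA; rewrite -[X @^-1` A]setTI; exact: mX. Qed.

Lemma measurable_wrtP G X :
  (forall A : set R, measurable A -> <<s G >> (X @^-1` A)) -> measurable_wrt G X.
Proof. by move=> GX _ A mA; rewrite setTI; exact: GX. Qed.

Lemma measurable_wrtD G X Y : measurable_wrt G X -> measurable_wrt G Y ->
  measurable_wrt G (fun w => X w + Y w).
Proof. exact: measurable_funD. Qed.

Lemma measurable_wrtB G X Y : measurable_wrt G X -> measurable_wrt G Y ->
  measurable_wrt G (fun w => X w - Y w).
Proof. exact: measurable_funB. Qed.

Lemma measurable_wrtZ G X c : measurable_wrt G X ->
  measurable_wrt G (fun w => c * X w).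
Proof. by move=> mX; exact: (measurable_funM (measurable_cst c) mX). Qed.

Lemma measurable_wrt_sum (I : eqType) (r : seq I) G (X : I -> T -> R) :
  (forall i, i \in r -> measurable_wrt G (X i)) ->
  measurable_wrt G (fun w => \sum_(i <- r) X i w).
Proof.
elim: r => [|i r IH] mX.
  have -> : (fun w => \sum_(i <- [::]) X i w) = cst 0.
    by apply/funext => w; rewrite big_nil.
  exact: measurable_cst.
have -> : (fun w => \sum_(j <- i :: r) X j w) = (fun w => X i w + \sum_(j <- r) X j w).
  by apply/funext => w; rewrite big_cons.
apply: measurable_wrtD; first by apply: mX; rewrite mem_head.
by apply: IH => j jr; apply: mX; rewrite in_cons jr orbT.
Qed.

Lemma measurable_wrt_sigma_gen (U : Type) (D : set U) (X : U -> T -> R) u : D u ->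
  measurable_wrt (\bigcup_(u in D) preimage_set_system [set: T] (X u)
    (@measurable _ (measurableTypeR R))) (X u).
Proof.
move=> Du; apply: measurable_wrtP => A mA; apply: sub_sigma_algebra.
by exists u => //; exists A => //; rewrite setTI.
Qed.

Lemma sub_sigma_gen (U : Type) (D : set U) (X : U -> T -> R) :
  (forall u, D u -> measurable_fun [set: T] (X u)) ->
  sigma_gen D X `<=` @measurable _ T.
Proof.
move=> mX; apply: smallest_sub; first exact: sigma_algebra_measurable.
by move=> _ [u Du] [A mA <-]; exact: mX.
Qed.

Lemma sigma_genI (U : Type) (D : set U) (X : U -> T -> R) : setI_closed (sigma_gen D X).
Proof.
move=> A B GA GB.
exact: (@measurableI _ (g_sigma_algebraType (\bigcup_(u in D) preimage_set_system
  [set: T] (X u)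
    (@measurable _ (measurableTypeR R)))) _ _ GA GB).
Qed.

Lemma sigma_genT (U : Type) (D : set U) (X : U -> T -> R) : sigma_gen D X [set: T].
Proof.
exact: (@measurableT _ (g_sigma_algebraType (\bigcup_(u in D) preimage_set_system
  [set: T] (X u)
    (@measurable _ (measurableTypeR R))))).
Qed.

(** Uniqueness of finite measures on a pi-system, applied to the restriction of [P] to [E] and to
    [P] scaled by [P E]. *)
Lemma indep_sigma_algebra (G : set (set T)) (E : set T) :
  setI_closed G -> G [set: T] -> G `<=` measurable -> measurable E ->
  (forall A, G A -> P (A `&` E) = (P A * P E)%E) ->
  forall A, <<s G >> A -> P (A `&` E) = (P A * P E)%E.
Proof.
move=> GI GT Gm mE GE A GA.
have p0 : 0 <= fine (P E) by rewrite fine_ge0.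
have PE : P E = (fine (P E))%:E by rewrite fineK// fin_num_measure.
rewrite muleC PE.
apply: (@g_sigma_algebra_measure_unique _ R T G Gm (fun=> setT) _ _
  (mrestr P mE) (mscale (NngNum p0) P) GI _ _ A GA) => //.
- by rewrite bigcup_const.
- move=> B GB; change (P (B `&` E) = (fine (P E))%:E * P B)%E.
  by rewrite GE// muleC {1}PE.
- move=> _; change (P (setT `&` E) < +oo)%E.
  by rewrite setTI PE ltry.
Qed.

(* The finite intersections of events of the first m sigma-algebras form a
   pi-system generating their join. *)
Lemma mutually_independent_sum (X : nat -> T -> R) (c : nat -> R) m :
  (forall k, measurable_fun [set: T] (X k)) ->
  mutually_independent P (fun k => sigma_gen [set k] X) ->
  indep P (fun w => \sum_(l <- iota 0 m) c l * X l w) (X m).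
Proof.
move=> mX iX B C mB mC.
pose F k := sigma_gen [set k] X.
have Fm k : F k `<=` measurable by apply: sub_sigma_gen => j _; exact: mX.
pose G := [set S | exists2 A : nat -> set T, forall l, F l (A l) &
  S = \bigcap_(l in [set` iota 0 m]) A l].
have FX k (D : set R) : measurable D -> F k (X k @^-1` D).
  by apply: measurable_wrt_preimage; exact: measurable_wrt_sigma_gen.
apply: (@indep_sigma_algebra G).
- move=> _ _ [A FA ->] [A' FA' ->]; exists (fun l => A l `&` A' l).
    by move=> l; apply: sigma_genI; [exact: FA|exact: FA'].
  by rewrite bigcapI.
- exists (fun=> setT); first by move=> l; exact: sigma_genT.
  by rewrite (_ : \bigcap_(l in _) _ = setT)//; apply/seteqP; split. 
- by move=> _ [A FA ->]; apply: bigcap_measurableType => k _; exact: (Fm k _ (FA k)).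
- by apply: (Fm m); exact: FX.
- move=> _ [A FA ->]; set E := X m @^-1` C.
  (* Placing [E] at index m turns the intersection with [E] into one over m+1 indices; comparing the
     product rules for m+1 and m indices splits off [P E]. *)
  pose A' l := if l == m then E else A l.
  have A'A l : l \in iota 0 m -> A' l = A l.
    by rewrite mem_iota add0n /A' => /andP[_ /ltn_eqF ->].
  have A'F l : F l (A' l).
    by rewrite /A'; case: eqP => [->|//]; exact: FX.
  have := iX (iota 0 m.+1) A' (iota_uniq _ _) (fun l _ => A'F l).
  rewrite -addn1 iotaD add0n big_cat big_seq1 {3}/A' eqxx.
  rewrite -(iX (iota 0 m) A' (iota_uniq _ _) (fun l _ => A'F l)).
  have <- : \bigcap_(l in [set` iota 0 m]) A' l = \bigcap_(l in [set` iota 0 m]) A l.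
    by apply: eq_bigcapr => l /A'A.
  move=> <-; congr (P _); apply/seteqP; split=> [w [Aw Ew] l|w Aw] /=.
    rewrite mem_cat inE => /orP[|/eqP ->]; first exact: Aw.
    by rewrite /A' eqxx.
  split=> [l lm|]; first by apply: Aw; rewrite /= mem_cat; apply/orP; left.
  by have := Aw m; rewrite /A' eqxx; apply; rewrite /= mem_cat mem_head orbT.
- apply: measurable_wrt_preimage => //.
  apply: measurable_wrt_sum => l lm; apply: measurable_wrtZ.
  apply: measurable_wrtP => D mD; apply: sub_sigma_algebra.
  exists (fun k => if k == l then X l @^-1` D else setT) => [k|].
    by case: eqP => [->|_]; [exact: FX|exact: sigma_genT].
  apply/seteqP; split => [w Dw k _|w /(_ l lm)]; first by case: eqP.
  by rewrite eqxx.
Qed.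

End GeneratedSigmaAlgebra.

(** * Stationary Gaussian increments *)

(** Only p boundary differences survive, however large n is; this is how the variance of the whole
    sum comes to be controlled by [G n]. *)
Lemma sum_lag_telescope (R : realType) (x : nat -> R) n p :
  \sum_(k < n) (x (k + p)%N - x k) = \sum_(q < p) (x (n + q)%N - x q).
Proof.
elim: n => [|n IH].
  by rewrite big_ord0 big1// => q _; rewrite add0n subrr.
have -> : \sum_(q < p) (x (n.+1 + q)%N - x q) =
    \sum_(q < p) (x (n + q)%N - x q) + \sum_(q < p) (x (n + q.+1)%N - x (n + q)%N).
  by rewrite -big_split/=; apply: eq_bigr => q _; rewrite addSnnS; ring.
rewrite big_ord_recr/= IH; congr (_ + _).
rewrite -(big_mkord xpredT (fun q => x (n + q.+1)%N - x (n + q)%N)).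
rewrite (@telescope_sumr _ 0 p (fun q => x (n + q)%N))// ?addn0//.
Qed.

(** Iterates (s + x)^2 <= 2 s^2 + 2 x^2. The crude constant is harmless, since p stays fixed while n
    grows. *)
Lemma sqr_sum_le (R : realType) (p : nat) (x : nat -> R) :
  (\sum_(q < p) x q) ^+ 2 <= 2 ^+ p * \sum_(q < p) x q ^+ 2.
Proof.
elim: p => [|p IH]; first by rewrite !big_ord0 expr0n mulr0.
rewrite !big_ord_recr/= (exprS 2 p).
set s := \sum_(q < p) x q in IH *; set t := \sum_(q < p) _ in IH *.
have p1 : (1 : R) <= 2 ^+ p by rewrite exprn_ege1// ler1n.
have h : 0 <= (s - x p) ^+ 2 by exact: sqr_ge0.
have h2 : 1 * x p ^+ 2 <= 2 ^+ p * x p ^+ 2 by rewrite ler_wpM2r// sqr_ge0.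
have -> : (s + x p) ^+ 2 = 2 * s ^+ 2 + 2 * x p ^+ 2 - (s - x p) ^+ 2 by ring.
have -> : 2 * 2 ^+ p * (t + x p ^+ 2) = 2 * (2 ^+ p * t) + 2 * (2 ^+ p * x p ^+ 2) by
  ring.
lra.
Qed.

Section StationaryIncrements.
Context (R : realType) d (T : measurableType d) (P : probability T R).
Variables (X : nat -> T -> R) (G : nat -> R).

(** Unit increments are the form in which Brownian independence is available. The variance is left
    existential and is read off later from the variogram. *)
Definition gauss_increments : Prop := forall m (c : nat -> R), exists v,
  gauss_moments P (fun w => \sum_(l <- iota 0 m) c l * (X l.+1 w - X l w)) v.

(** With truncated subtraction, [(k - j) + (j - k)] is the distance |k - j|. *)
Definition variogram : Prop := forall j k,
  has_integral P (fun w => (X k w - X j w) ^+ 2) (G ((k - j) + (j - k))%N).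

Hypothesis gX : gauss_increments.
Hypothesis vX : variogram.

Lemma increment_iotaE m j p w : (j + p <= m)%N ->
  \sum_(l <- iota 0 m) ((j <= l < j + p)%N%:R) * (X l.+1 w - X l w) =
  X (j + p)%N w - X j w.
Proof.
move=> jpm.
transitivity (\sum_(j <= l < j + p) (X l.+1 w - X l w)).
  rewrite -[m]subn0 -/(index_iota 0 m) [RHS](big_nat_widenl _ 0)//=.
  rewrite [RHS](big_nat_widen _ _ m)//= [RHS]big_mkcond/=; apply: eq_bigr => l _.
  by rewrite andbC; case: ifP => _; rewrite ?mul1r ?mul0r.
by rewrite (telescope_sumr (fun l => X l w))// leq_addr.
Qed.

Variable p : nat.
Let D k w := X (k + p)%N w - X k w.
Let v := G p.
(** The covariance of [D j] and [D k]: half the second difference, with step p, of the even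
    extension of [G] at j - k. *)
Let r j k := (G (((j + p) - k) + (k - (j + p)))%N + G ((j - (k + p)) + ((k + p) -
  j))%N) / 2
  - G ((j - k) + (k - j))%N.

Let gD_comb j k a b : exists u, gauss_moments P (fun w => a * D j w + b * D k w) u.
Proof.
have [u gu] := gX (j + k + p)
  (fun l => a * (j <= l < j + p)%N%:R + b * (k <= l < k + p)%N%:R).
exists u; apply: eq_gauss_moments gu => // w.
rewrite /D -(@increment_iotaE (j + k + p) j p w)//; last by lia.
rewrite -(@increment_iotaE (j + k + p) k p w)//; last by lia.
rewrite !mulr_sumr -big_split/=; apply: eq_bigr => l _.
by rewrite mulrDl !mulrA.
Qed.

Let gD k : gauss_moments P (D k) v.
Proof.
have [u gu] := gD_comb k k 1 0.
have gu' : gauss_moments P (D k) u.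
  by apply: eq_gauss_moments gu => // w; rewrite mul1r mul0r addr0.
suff -> : v = u by [].
have [_ h2 _ _] := gu'.
apply: (has_integral_inj _ h2).
apply: eq_has_integral (vX k (k + p)%N) => //.
by rewrite /v; congr G; lia.
Qed.

Let gDD j k (e : R) : e ^+ 2 = 1 ->
  gauss_moments P (fun w => D j w + e * D k w) (2 * v + 2 * e * r j k).
Proof.
move=> e1.
have [u gu] := gD_comb j k 1 e.
have gu' : gauss_moments P (fun w => D j w + e * D k w) u.
  by apply: eq_gauss_moments gu => // w; rewrite mul1r.
suff -> : 2 * v + 2 * e * r j k = u by [].
have [_ h2 _ _] := gu'; apply: (has_integral_inj _ h2).
(* The cross term is turned into variogram values by 2(a-b)(x-y) = (a-y)^2 + (x-b)^2 - (x-a)^2 -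
   (y-b)^2. *)
apply: eq_has_integral (has_integralD (has_integralD (vX j (j + p)%N) (vX k (k + p)%N))
  (has_integralZ e (has_integralD
     (has_integralD (vX k (j + p)%N) (vX (k + p)%N j))
     (has_integralZ (-1) (has_integralD (vX (k + p)%N (j + p)%N) (vX k j)))))) => [w|].
  rewrite /D; set a := X (j + p)%N w; set b := X j w; set x := X (k + p)%N w; set y
    := X k w.
  have -> : (x - y) ^+ 2 = e ^+ 2 * (x - y) ^+ 2 by rewrite e1 mul1r.
  ring.
have -> : (j + p - j + (j - (j + p)))%N = p by lia.
have -> : (k + p - k + (k - (k + p)))%N = p by lia.
have -> : (j + p - (k + p) + (k + p - (j + p)))%N = (j - k + (k - j))%N by lia.
by rewrite /r /v; field.
Qed.

Hypothesis r_ge0 : forall j k, 0 <= r j k.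

Let gDp j k : gauss_moments P (fun w => D j w + D k w) (2 * v + 2 * r j k).
Proof.
by apply: eq_gauss_moments (@gDD j k 1 (expr1n _ _)) => [w|]; rewrite ?mul1r// mulr1.
Qed.

Let gDm j k : gauss_moments P (fun w => D j w - D k w) (2 * v - 2 * r j k).
Proof.
apply: eq_gauss_moments (@gDD j k (-1) _) => [w||]; first by rewrite mulN1r.
- by rewrite mulrN1 mulNr.
- by rewrite sqrrN expr1n.
Qed.

(** The second moment is the double sum of 2r^2 + 4c^2 r, at most (2v + 4c^2) times the double sum
    of r. After telescoping, the latter is the second moment of p differences at distance n, each
    contributing [G n]. *)
Lemma sqr_increments_variance (c : R) n : exists2 a,
  has_integral P (fun w => (\sum_(k < n) ((X (k + p)%N w - X k w + c) ^+ 2 - (G p + c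
    ^+ 2))) ^+ 2) a &
  a <= (2 * G p + 4 * c ^+ 2) * (2 ^+ p * (p%:R * G n)).
Proof.
pose Y k w := (D k w + c) ^+ 2 - (v + c ^+ 2).
have hY j k : has_integral P (fun w => Y j w * Y k w) (2 * r j k ^+ 2 + 4 * c ^+ 2 *
  r j k).
  exact: gauss_moments_cov_sqr.
have hD j k : has_integral P (fun w => D j w * D k w) (r j k).
  exact: (gauss_moments_XY (gD j) (gD k) (gDp j k)).
have rv j k : r j k <= v.
  rewrite -(ger0_norm (r_ge0 j k)).
  exact: (gauss_moments_cov_le (gDp j k) (gDm j k)).
exists (\sum_(j < n) \sum_(k < n) (2 * r j k ^+ 2 + 4 * c ^+ 2 * r j k)).
  apply: eq_has_integral (has_integral_sum _ (fun j : 'I_n =>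
    has_integral_sum _ (fun k : 'I_n => hY j k))) => [w|//].
  by rewrite expr2 big_distrlr.
have sr : \sum_(j < n) \sum_(k < n) r j k <= 2 ^+ p * (p%:R * G n).
  have h1 : has_integral P (fun w => (\sum_(k < n) D k w) ^+ 2) (\sum_(j < n) \sum_(k
    < n) r j k).
    apply: eq_has_integral (has_integral_sum _ (fun j : 'I_n =>
      has_integral_sum _ (fun k : 'I_n => hD j k))) => [w|//].
    by rewrite expr2 big_distrlr.
  have h2 : has_integral P (fun w => 2 ^+ p * \sum_(q < p) (X (n + q)%N w - X q w) ^+ 2)
      (2 ^+ p * (p%:R * G n)).
    apply: has_integralZ.
    apply: eq_has_integral (has_integral_sum (index_enum 'I_p) (fun q : 'I_p => vX q
      (n + q)%N)) => [//|].
    rewrite (eq_bigr (fun=> G n)); first by rewrite sumr_const card_ord mulr_natl.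
    by move=> q _; congr G; lia.
  apply: has_integral_le h1 h2 _ => w.
  have -> : \sum_(k < n) D k w = \sum_(q < p) (X (n + q)%N w - X q w).
    exact: (@sum_lag_telescope _ (fun k => X k w)).
  exact: (@sqr_sum_le _ p (fun q => X (n + q)%N w - X q w)).
have v0 : 0 <= v by exact: le_trans (r_ge0 0 0) (rv 0%N 0%N).
have c0 : 0 <= 2 * v + 4 * c ^+ 2 by rewrite addr_ge0// mulr_ge0// sqr_ge0.
apply: (le_trans _ (ler_wpM2l c0 sr)).
rewrite mulr_sumr; apply: ler_sum => j _; rewrite mulr_sumr; apply: ler_sum => k _.
rewrite [leRHS]mulrDl lerD2r (_ : 2 * _ ^+ 2 = 2 * (r j k * r j k)); last by ring.
by rewrite -mulrA ler_wpM2l// ler_wpM2r.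
Qed.

End StationaryIncrements.

(** * Strong law for nonnegative variables *)

Lemma nneseries_fin_cvg0 (R : realType) (u : nat -> R) : (forall n, 0 <= u n) ->
  (\sum_(0 <= n <oo) (u n)%:E < +oo)%E -> u n @[n --> \oo] --> 0.
Proof.
move=> u0 ufin; apply: cvg_series_cvg_0.
apply: nondecreasing_is_cvgn.
  by apply/nondecreasing_seqP => n; rewrite seriesEnat/= big_nat_recr//= lerDl.
exists (fine (\sum_(0 <= n <oo) (u n)%:E)%E) => _ [n _ <-].
rewrite -lee_fin fineK; last first.
  by rewrite ge0_fin_numE// nneseries_ge0// => k _ _; rewrite lee_fin.
rewrite seriesEnat/= -sumEFin; apply: nneseries_lim_ge => k _ _.
by rewrite lee_fin.
Qed.

Lemma sum_inv_sqr_le (R : realType) n : \sum_(0 <= k < n) (k.+1%:R ^- 2 : R) <= 2.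
Proof.
case: n => [|n]; first by rewrite big_nil.
(* The strengthened bound is inductive because 1/(x+1)^2 <= 1/x - 1/(x+1). *)
suff : \sum_(0 <= k < n.+1) (k.+1%:R ^- 2 : R) <= 2 - (n.+1%:R)^-1.
  by move=> /le_trans; apply; rewrite gerBl.
elim: n => [|n IH]; first by rewrite big_nat1 expr1n invr1; lra.
rewrite big_nat_recr//=; apply: (le_trans (lerD IH (lexx _))).
have x0 : 0 < n.+1%:R :> R by rewrite ltr0n.
rewrite -[n.+2%:R]natr1; set x := n.+1%:R in x0 *.
rewrite -subr_ge0 (_ : _ - _ = (x * (x + 1) ^+ 2)^-1).
  by rewrite invr_ge0 mulr_ge0 ?sqr_ge0// ltW.
by field; rewrite !gt_eqF//= addr_gt0.
Qed.

Section StrongLaw.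
Context (R : realType) d (T : measurableType d) (P : probability T R).

(** Integrating the series termwise shows that its sum is integrable, hence finite almost
    everywhere, so its terms tend to 0. *)
Lemma ae_cvg0_of_summable (f : nat -> T -> R) (a : nat -> R) C :
  (forall n w, 0 <= f n w) -> (forall n, has_integral P (f n) (a n)) ->
  (forall n, a n <= C * n.+1%:R ^- 2) ->
  {ae P, forall w, f n w @[n --> \oo] --> 0}.
Proof.
move=> f0 fa aC.
have mf n : measurable_fun [set: T] (fun w => (f n w)%:E).
  exact/measurable_EFinP/has_integral_measurable/fa.
pose F w := (\sum_(0 <= n <oo) (f n w)%:E)%E.
have F0 w : (0 <= F w)%E by apply: nneseries_ge0 => n _ _; rewrite lee_fin.
have iF : P.-integrable [set: T] F.
  apply/integrableP; split.
    by apply: ge0_emeasurable_sum => // n w _ _; rewrite lee_fin.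
  under eq_integral do rewrite gee0_abs//.
  rewrite integral_nneseries//; last by move=> n w _; rewrite lee_fin.
  rewrite (le_lt_trans _ (ltry (C * 2)))//.
  apply: lime_le.
    apply: is_cvg_nneseries => n _ _.
    by apply: integral_ge0 => w _; rewrite lee_fin.
  apply: nearW => n.
  rewrite (eq_bigr (fun k => (a k)%:E)); last by move=> k _; case: (fa k).
  rewrite sumEFin lee_fin.
  apply: (@le_trans _ _ (\sum_(0 <= k < n) C * k.+1%:R ^- 2)).
    by apply: ler_sum.
  rewrite -mulr_sumr ler_wpM2l ?sum_inv_sqr_le//.
  have := le_trans (has_integral_ge0 (fa 0%N) (f0 0%N)) (aC 0%N).
  by rewrite expr1n invr1 mulr1.
apply: filterS (integrable_ae measurableT iF) => w /(_ I) Fw.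
by apply: nneseries_fin_cvg0 => //; rewrite -(ge0_fin_numE (F0 w)).
Qed.

Lemma fourth_root_bracket n M : (M ^ 4 <= n)%N ->
  exists m, [/\ (M <= m)%N, (m ^ 4 <= n)%N & (n <= m.+1 ^ 4)%N].
Proof.
move=> Mn.
have ub k : (k ^ 4 <= n)%N -> (k <= n)%N.
  by apply: leq_trans; case: k => // k; rewrite -{1}[k.+1]expn1 leq_pexp2l.
case: (ex_maxnP (ex_intro _ M Mn) ub) => m mn max; exists m; split => //.
  exact: max.
by rewrite leqNgt; apply/negP => /ltnW/max; rewrite ltnn.
Qed.

(** For m^4 <= n <= (m+1)^4 monotonicity puts S n / n between S(m^4) / (m+1)^4 and S((m+1)^4) / m^4,
    and both tend to l. [S 0 = 0] makes S nonnegative, so the inequalities may be multiplied. *)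
Lemma cvg_average_of_fourth_powers (S : nat -> R) (l : R) : S 0%N = 0 ->
  {homo S : m n / (m <= n)%N >-> m <= n} ->
  S (m.+1 ^ 4)%N / (m.+1 ^ 4)%:R @[m --> \oo] --> l ->
  S n / n%:R @[n --> \oo] --> l.
Proof.
move=> S0 ndS Sl.
have S_ge0 n : 0 <= S n by rewrite -S0 ndS.
have q1 : (m.+2%:R / m.+1%:R : R) @[m --> \oo] --> (1 : R).
  rewrite (_ : (fun m => _) = (fun m => 1 + (m.+1%:R : R)^-1)).
    rewrite -[X in _ --> X]addr0; apply: cvgD; first exact: cvg_cst.
    exact: cvg_harmonic.
  by apply/funext => m; rewrite -[m.+2%:R]natr1 mulrDl divff// mul1r.
have q4 : ((m.+2 ^ 4)%:R / (m.+1 ^ 4)%:R : R) @[m --> \oo] --> (1 : R).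
  have -> : (fun m => (m.+2 ^ 4)%:R / (m.+1 ^ 4)%:R : R) = (fun m => (m.+2%:R /
    m.+1%:R : R) ^+ 4).
    by apply/funext => m; rewrite !natrX exprMn exprVn.
  rewrite -[X in _ --> X](expr1n _ 4).
  exact: (cvg_comp _ _ q1 (@exprn_continuous R 4 1)).
have U : S (m.+2 ^ 4)%N / (m.+1 ^ 4)%:R @[m --> \oo] --> l.
  have -> : (fun m => S (m.+2 ^ 4)%N / (m.+1 ^ 4)%:R) =
      (fun m => S (m.+2 ^ 4)%N / (m.+2 ^ 4)%:R * ((m.+2 ^ 4)%:R / (m.+1 ^ 4)%:R)).
    by apply/funext => m; rewrite mulrA divfK// pnatr_eq0 expn_eq0.
  rewrite -[X in _ --> X]mulr1; apply: cvgM => //.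
  by rewrite (cvg_shiftS (fun m => S (m.+1 ^ 4)%N / (m.+1 ^ 4)%:R)).
have L : S (m.+1 ^ 4)%N / (m.+2 ^ 4)%:R @[m --> \oo] --> l.
  have -> : (fun m => S (m.+1 ^ 4)%N / (m.+2 ^ 4)%:R) =
      (fun m => S (m.+1 ^ 4)%N / (m.+1 ^ 4)%:R * ((m.+2 ^ 4)%:R / (m.+1 ^ 4)%:R)^-1).
    by apply/funext => m; rewrite invf_div mulrA divfK// pnatr_eq0 expn_eq0.
  rewrite -[X in _ --> X]mulr1 -[X in _ * X]invr1; apply: cvgM => //.
  by apply: cvgV => //; exact: oner_neq0.
apply/cvgrPdist_le => e e0.
have [N1 _ hU] := (cvgrPdist_le _ _).1 U e e0.
have [N2 _ hL] := (cvgrPdist_le _ _).1 L e e0.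
(* The extra successor excludes the root 0, as [U] and [L] are indexed by m with root m+1. *)
exists ((maxn N1 N2).+1 ^ 4)%N => // n /= /fourth_root_bracket[[|m] [mN mn nm]];
  first by [].
have {}hU := hU m (leq_trans (leq_maxl _ _) mN).
have {}hL := hL m (leq_trans (leq_maxr _ _) mN).
have n0 : (0 < n)%N by rewrite (leq_trans _ mn)// expn_gt0.
have Un : S n / n%:R <= S (m.+2 ^ 4)%N / (m.+1 ^ 4)%:R.
  by rewrite ler_pM ?invr_ge0 ?ler_pV2 ?ler_nat ?ndS// inE ?unitfE ?pnatr_eq0 ?ltr0n
    ?expn_gt0 -?lt0n ?n0 ?expn_gt0.
have Ln : S (m.+1 ^ 4)%N / (m.+2 ^ 4)%:R <= S n / n%:R.
  by rewrite ler_pM ?invr_ge0 ?ler_pV2 ?ler_nat ?ndS// inE ?unitfE ?pnatr_eq0 ?ltr0n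
    ?expn_gt0 -?lt0n ?n0 ?expn_gt0.
move: hU hL => /=; rewrite !ler_norml => /andP[u1 u2] /andP[l1 l2].
apply/andP; split; [apply: le_trans u1 _|apply: le_trans l2].
  by rewrite lerD2l lerN2.
by rewrite lerD2l lerN2.
Qed.

Lemma strong_law (Y : nat -> T -> R) (l C : R) : (forall k w, 0 <= Y k w) ->
  (forall n, exists2 a, has_integral P (fun w => (\sum_(k < n ^ 4) (Y k w - l)) ^+ 2)
    a &
     a <= C * n%:R ^+ 6) ->
  {ae P, forall w, (\sum_(k < n) Y k w) / n%:R @[n --> \oo] --> l}.
Proof.
move=> Y0 hY.
have /choice[a ha] : forall m, exists a, has_integral P
    (fun w => (\sum_(k < m.+1 ^ 4) (Y k w - l)) ^+ 2) a /\ a <= C * m.+1%:R ^+ 6.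
  by move=> m; have [a] := hY m.+1; exists a.
pose f m w := ((\sum_(k < m.+1 ^ 4) (Y k w - l)) / (m.+1 ^ 4)%:R) ^+ 2.
have hf m : has_integral P (f m) ((m.+1 ^ 4)%:R ^- 2 * a m).
  have [h _] := ha m; apply: eq_has_integral (has_integralZ _ h) => // w.
  by rewrite /f exprMn exprVn mulrC.
have : {ae P, forall w, f m w @[m --> \oo] --> 0}.
  apply: (ae_cvg0_of_summable (C := C) _ hf) => [m w|m]; first exact: sqr_ge0.
  have [_ am] := ha m.
  apply: (le_trans (ler_wpM2l _ am)); first by rewrite invr_ge0 exprn_ge0.
  rewrite natrX le_eqVlt; apply/orP; left; apply/eqP.
  have : m.+1%:R != 0 :> R by rewrite pnatr_eq0.
  by move: m.+1%:R => x x0; field.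
apply: filterS => w fw.
apply: cvg_average_of_fourth_powers.
- by rewrite big_ord0.
- move=> m n mn; rewrite -!(big_mkord xpredT (Y ^~ w)).
  by rewrite (big_cat_nat (leq0n m) mn)//= lerDl sumr_ge0.
- apply/subr_cvg0; apply/norm_cvg0P.
  have -> : (fun m => `|(\sum_(k < m.+1 ^ 4) Y k w) / (m.+1 ^ 4)%:R - l|) = (fun m =>
    Num.sqrt (f m w)).
    apply/funext => m; rewrite sqrtr_sqr; congr (`| _ |).
    rewrite sumrB sumr_const card_ord mulrBl -(mulr_natr l) mulfK// pnatr_eq0
      expn_eq0//.
  rewrite -sqrtr0; exact: (cvg_comp _ _ fw (@sqrt_continuous R 0)).
Qed.

End StrongLaw.

(** * Mixed fractional Brownian motion *)

Section Processes.
Context (R : realType) d (T : measurableType d) (P : probability T R).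

(** Induction on m: the new increment is independent of the combination of the earlier ones, and
    [gauss_momentsD] adds the variances. *)
Lemma brownian_gauss_increments (h : R) (B : R -> {RV P >-> R}) : 0 <= h ->
  standard_brownian B -> gauss_increments P (fun k => B (k%:R * h) : T -> R).
Proof.
move=> h0 [_ lawB indB _] m c.
have tmono : {homo (fun k : nat => k%:R * h) : j k / (j <= k)%N >-> j <= k}.
  by move=> j k jk; rewrite ler_wpM2r// ler_nat.
have mB k : measurable_fun [set: T] (fun w => B (k.+1%:R * h) w - B (k%:R * h) w).
  by apply: measurable_funB.
have iB := indB _ (mulr_ge0 (ler0n _ 0) h0) tmono.
have gB k : gauss_moments P (fun w => B (k.+1%:R * h) w - B (k%:R * h) w) (k.+1%:R *
  h - k%:R * h).
  have kk : k%:R * h <= k.+1%:R * h by exact: tmono.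
  apply: has_law_gauss_moments => //; first by rewrite subr_ge0.
  by apply: lawB => //; rewrite mulr_ge0.
elim: m => [|m [v IH]].
  exists 0; have h00 := has_integral0 P.
  by split; apply: eq_has_integral h00 => [w|]; rewrite ?big_nil ?expr0n//= mulr0.
exists (v + c m ^+ 2 * (m.+1%:R * h - m%:R * h)).
have ind := @mutually_independent_sum R d T P _ c m mB iB.
have mc : measurable_fun [set: R] (fun x => c m * x) by exact: measurable_funM.
have ind' := indep_comp (f := id) (@measurable_id _ _ _) mc ind.
apply: eq_gauss_moments (gauss_momentsD ind' IH (gauss_momentsZ (c m) (gB m))) => // w.
by rewrite -[in RHS]addn1 iotaD big_cat/= big_seq1 add0n.
Qed.

Lemma brownian_variogram (h : R) (B : R -> {RV P >-> R}) : 0 <= h ->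
  standard_brownian B ->
  variogram P (fun k => B (k%:R * h) : T -> R) (fun n => n%:R * h).
Proof.
move=> h0 [_ lawB _ _].
have V j k : (j <= k)%N ->
    has_integral P (fun w => (B (k%:R * h) w - B (j%:R * h) w) ^+ 2) ((k - j)%:R * h).
  move=> jk.
  have tjk : j%:R * h <= k%:R * h by rewrite ler_wpM2r// ler_nat.
  rewrite natrB// mulrBl.
  have [] // : gauss_moments P (fun w => B (k%:R * h) w - B (j%:R * h) w) (k%:R * h -
    j%:R * h).
  apply: has_law_gauss_moments; first exact: measurable_funB.
    by rewrite subr_ge0.
  by apply: lawB => //; rewrite mulr_ge0.
move=> j k; have [jk|/ltnW kj] := leqP j k.
  by apply: eq_has_integral (V _ _ jk) => //; congr (_%:R * h); lia.
apply: eq_has_integral (V _ _ kj) => [w|]; first by rewrite -sqrrN opprB.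
by congr (_%:R * h); lia.
Qed.

Lemma fbm_gauss_increments (H h : R) (X : R -> {RV P >-> R}) : 0 <= h ->
  fractional_brownian H X -> gauss_increments P (fun k => X (k%:R * h) : T -> R).
Proof.
move=> h0 [gX _] m c.
(* Abel summation: the weight of X at grid point l is c (l-1) - c l, with missing terms read as 0 at
   both ends. *)
pose c' (l : nat) := (if l is l'.+1 then c l' else 0) - (if (l < m)%N then c l else 0).
have [v v0 lv] := gX m.+1 (fun k => k%:R * h) c' (fun k => mulr_ge0 (ler0n _ _) h0).
exists v; apply: eq_gauss_moments (has_law_gauss_moments _ v0 lv) => // [w|].
  rewrite /c'; under eq_bigr do rewrite mulrBl.
  rewrite sumrB big_ord_recl/= mul0r add0r big_ord_recr/= ltnn mul0r addr0.
  rewrite -[m in iota _ m]subn0 -/(index_iota 0 m) big_mkord -sumrB.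
  by apply: eq_bigr => l _; rewrite ltn_ord mulrBr.
apply: measurable_sum => k; exact: measurable_funM.
Qed.

Lemma fbm_variogram (H h : R) (X : R -> {RV P >-> R}) : 0 <= h -> 0 < H ->
  fractional_brownian H X ->
  variogram P (fun k => X (k%:R * h) : T -> R) (fun n => (n%:R * h) `^ (2 * H)).
Proof.
move=> h0 H0 [gX cX] j k.
have H2 : 2 * H != 0 by rewrite gt_eqF// mulr_gt0.
set s := j%:R * h; set t := k%:R * h.
have s0 : 0 <= s by rewrite mulr_ge0. have t0 : 0 <= t by rewrite mulr_ge0.
have g2 (u u' a b : R) : 0 <= u -> 0 <= u' ->
    exists v, gauss_moments P (fun w => a * X u w + b * X u' w) v.
  move=> u0 u'0.
  have [|v v0 lv] := gX 2 (fun i => if i == ord0 then u else u') (fun i => if i ==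
    ord0 then a else b).
    by move=> i; case: ifP.
  exists v; apply: eq_gauss_moments (has_law_gauss_moments _ v0 lv) => // [w|].
    by rewrite !big_ord_recl big_ord0/= addr0.
  by apply: measurable_sum => i; exact: measurable_funM.
have g1 u : 0 <= u -> has_integral P (X u) 0.
  move=> u0; have [v [h1 _ _ _]] := g2 u u 1 0 u0 u0.
  by apply: eq_has_integral h1 => // w; rewrite mul1r mul0r addr0.
have cov u u' : 0 <= u -> 0 <= u' -> has_integral P (fun w => X u w * X u' w)
    ((u' `^ (2 * H) + u `^ (2 * H) - `|u' - u| `^ (2 * H)) / 2).
  move=> u0 u'0.
  have [v1 [_ h1 _ _]] := g2 u u' 1 1 u0 u'0.
  have [v2 [_ h2 _ _]] := g2 u u' 1 (-1) u0 u'0.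
  have hc : has_integral P (fun w => X u w * X u' w) (4^-1 * (v1 + -1 * v2)).
    apply: eq_has_integral (has_integralZ 4^-1 (has_integralD h1 (has_integralZ (-1)
      h2))) => // w.
    by field.
  apply: (eq_has_integral _ _ hc) => //.
  have := cX u u' u0 u'0; case: hc => _ hc.
  (* [covariance] subtracts the means; they vanish, so it equals the integral of the plain
     product. *)
  have E0 u1 : 0 <= u1 -> fine 'E_P[X u1] = 0.
    by move=> /g1[_]; rewrite unlock => ->.
  rewrite unlock (E0 _ u0) (E0 _ u'0) unlock => ce.
  apply: EFin_inj; rewrite -ce -hc; apply: eq_integral => w _.
  by rewrite -[in LHS](subr0 (X u w)) -[in LHS](subr0 (X u' w)).
apply: eq_has_integral (has_integralD (has_integralD (cov _ _ t0 t0) (cov _ _ s0 s0))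
  (has_integralZ (-2) (cov _ _ s0 t0))) => [w|]; first by ring.
rewrite !subrr normr0 powR0//.
have -> : (k - j + (j - k))%:R * h = `|t - s|.
  rewrite /t /s -mulrBl normrM (ger0_norm h0); congr (_ * h).
  have [jk|/ltnW kj] := leqP j k.
    by rewrite ger0_norm ?subr_ge0 ?ler_nat// -natrB//; congr _%:R; lia.
  by rewrite ler0_norm ?subr_le0 ?ler_nat// opprB -natrB//; congr _%:R; lia.
by field.
Qed.

End Processes.

Lemma powR_midpoint_le (R : realType) (p x y : R) : 1 <= p -> 0 <= x -> 0 <= y ->
  ((x + y) / 2) `^ p <= (x `^ p + y `^ p) / 2.
Proof.
move=> p1 x0 y0.
rewrite !mulrDl ![_ / 2]mulrC {2 4}(_ : 2^-1 = 1 - 2^-1); last by field.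
by apply: (convex_powR p1 (Itv01 _ _)) => //=;
  rewrite ?inE/= ?in_itv/= ?andbT// ?invr_ge0// invf_le1 ?ler1n.
Qed.

Section MixedProcess.
Context (R : realType) d (T : measurableType d) (P : probability T R).
Variables (sigma gamma H h : R) (B BH : R -> {RV P >-> R}).
Hypotheses (h0 : 0 < h) (H_gt : 1 / 2 < H) (H_lt : H < 3 / 4).
Hypotheses (B_bm : standard_brownian B) (BH_fbm : fractional_brownian H BH).
Hypothesis B_BH : independent2 P
  (sigma_gen [set t : R | 0 <= t] (fun t => B t : T -> R))
  (sigma_gen [set t : R | 0 <= t] (fun t => BH t : T -> R)).

Definition mixed_variogram (sigma gamma H h : R) (n : nat) : R :=
  sigma ^+ 2 * (n%:R * h) + gamma ^+ 2 * (n%:R * h) `^ (2 * H).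

Let M (k : nat) (w : T) : R := sigma * B (k%:R * h) w + gamma * BH (k%:R * h) w.
Local Notation G := (mixed_variogram sigma gamma H h).
Local Notation SB X := (\bigcup_(t in [set t : R | 0 <= t])
  preimage_set_system [set: T] (X t : T -> R) (@measurable _ (measurableTypeR R))).

Let indep_wrt f g : measurable_wrt (SB B) f -> measurable_wrt (SB BH) g -> indep P f g.
Proof.
move=> mf mg A C mA mC; apply: B_BH; exact: measurable_wrt_preimage.
Qed.

Let grid_ge0 (k : nat) : [set t : R | 0 <= t] (k%:R * h).
Proof. by rewrite /= mulr_ge0// ltW. Qed.

Let increment_wrt (X : R -> {RV P >-> R}) j k a :
  measurable_wrt (SB X) (fun w => a * (X (k%:R * h) w - X (j%:R * h) w)).
Proof.
apply: measurable_wrtZ; apply: measurable_wrtB.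
  exact: (@measurable_wrt_sigma_gen _ _ _ _ _ (fun t => X t : T -> R)).
exact: (@measurable_wrt_sigma_gen _ _ _ _ _ (fun t => X t : T -> R)).
Qed.

Lemma mixed_gauss_increments : gauss_increments P M.
Proof.
move=> m c.
have [v gB] := brownian_gauss_increments (ltW h0) B_bm m c.
have [u gF] := fbm_gauss_increments (ltW h0) BH_fbm m c.
exists (sigma ^+ 2 * v + gamma ^+ 2 * u).
have ind : indep P
    (fun w => sigma * \sum_(l <- iota 0 m) c l * (B (l.+1%:R * h) w - B (l%:R * h) w))
    (fun w => gamma * \sum_(l <- iota 0 m) c l * (BH (l.+1%:R * h) w - BH (l%:R * h)
      w)).
  by apply: indep_wrt; apply: measurable_wrtZ; apply: measurable_wrt_sum => l _;
    exact: increment_wrt.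
apply: eq_gauss_moments (gauss_momentsD ind (gauss_momentsZ sigma gB) (gauss_momentsZ
  gamma gF)) => // w.
rewrite !mulr_sumr -big_split/=; apply: eq_bigr => l _.
by rewrite /M; ring.
Qed.

Lemma mixed_process_variogram : variogram P M G.
Proof.
move=> j k.
have H0 : 0 < H by move: H_gt; lra.
have vB := brownian_variogram (ltW h0) B_bm j k.
have vF := fbm_variogram (ltW h0) H0 BH_fbm j k.
have mean0 X : gauss_increments P X -> has_integral P (fun w => X k w - X j w) 0.
  wlog jk : j k {vB vF} / (j <= k)%N => [wl gX|gX].
    have [jk|/ltnW kj] := leqP j k; first exact: wl.
    by apply: eq_has_integral (has_integralZ (-1) (wl _ _ kj gX)) => [w|]; rewrite
      ?mulr0// mulN1r opprB.
  have [v [hv _ _ _]] := gX k (fun l => (j <= l < j + (k - j))%N%:R).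
  apply: eq_has_integral hv => // w.
  by rewrite increment_iotaE subnKC.
(* The factor 1 matches the shape of [increment_wrt]. Being centered and independent, the two
   increments have zero cross moment. *)
have iB : has_integral P (fun w => 1 * (B (k%:R * h) w - B (j%:R * h) w)) 0.
  have := mean0 _ (brownian_gauss_increments (ltW h0) B_bm).
  by apply: eq_has_integral => // w; rewrite mul1r.
have iF : has_integral P (fun w => 1 * (BH (k%:R * h) w - BH (j%:R * h) w)) 0.
  have := mean0 _ (fbm_gauss_increments (ltW h0) BH_fbm).
  by apply: eq_has_integral => // w; rewrite mul1r.
have iBF := has_integralM (indep_wrt (@increment_wrt B j k 1) (@increment_wrt BH j k
  1)) iB iF.
apply: eq_has_integral (has_integralD
  (has_integralD (has_integralZ (sigma ^+ 2) vB) (has_integralZ (gamma ^+ 2) vF))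
  (has_integralZ (2 * sigma * gamma) iBF)) => [w|].
  by rewrite /M; ring.
by rewrite mulr0 mulr0 addr0.
Qed.

(** Monotonicity is needed besides convexity: with i = j - k, the mean of |i + p| and |i - p| is |i|
    when |i| >= p, but p, hence larger than |i|, otherwise. *)
Lemma mixed_variogram_convex j k p :
  0 <= (G (((j + p) - k) + (k - (j + p)))%N + G ((j - (k + p)) + ((k + p) - j))%N) / 2
  - G ((j - k) + (k - j))%N.
Proof.
set a := (((j + p) - k) + _)%N; set b := (_ - _ + (_ + _ - _))%N; set c := ((j - k) +
  _)%N.
have cab : (2 * c <= a + b)%N by rewrite /a /b /c; lia.
have p1 : 1 <= 2 * H by move: H_gt; lra.
have hn n : 0 <= n%:R * h by rewrite mulr_ge0// ltW.
have cab' : c%:R * h <= (a%:R * h + b%:R * h) / 2.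
  rewrite -mulrDl -natrD ler_pdivlMr// mulrC mulrA ler_pM2r// -natrM ler_nat//.
have pc := powR_midpoint_le p1 (hn a) (hn b).
have mono : (c%:R * h) `^ (2 * H) <= ((a%:R * h + b%:R * h) / 2) `^ (2 * H).
  apply: ge0_ler_powR => //; rewrite ?nnegrE//; first by move: H_gt; lra.
  by rewrite divr_ge0// addr_ge0.
have k1 := ler_wpM2l (sqr_ge0 sigma) cab'.
have k2 := ler_wpM2l (sqr_ge0 gamma) (le_trans mono pc).
rewrite /mixed_variogram; lra.
Qed.

(** The fractional term has exponent 8H <= 6, which is the role of H < 3/4; the Brownian term has
    only exponent 4. *)
Lemma mixed_variogram_fourth_power n :
  G (n ^ 4)%N <= (sigma ^+ 2 * h + gamma ^+ 2 * h `^ (2 * H)) * n%:R ^+ 6.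
Proof.
rewrite /mixed_variogram; case: n => [|n].
  by rewrite exp0n// mul0r powR0 ?expr0n//= ?mulr0 ?addr0// gt_eqF//; move: H_gt; lra.
set x : R := n.+1%:R.
have x1 : 1 <= x by rewrite ler1n.
have x0 : 0 <= x by rewrite (le_trans _ x1).
have xH : (x ^+ 4) `^ (2 * H) <= x ^+ 6.
  rewrite -[x ^+ 4]powR_mulrn// -powRrM -[x ^+ 6]powR_mulrn// ler_powR//.
  move: H_lt; lra.
rewrite natrX powRM ?exprn_ge0 ?(ltW h0)// [leRHS]mulrDl; apply: lerD.
  rewrite -[leRHS]mulrA; apply: ler_wpM2l; first exact: sqr_ge0.
  by rewrite [leRHS]mulrC ler_wpM2r ?(ltW h0)// ler_weXn2l.
rewrite -[leRHS]mulrA; apply: ler_wpM2l; first exact: sqr_ge0.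
by rewrite [leRHS]mulrC ler_wpM2r ?powR_ge0.
Qed.

Lemma mixed_average_cvg p c : {ae P, forall w,
  (\sum_(k < n) (M (k + p)%N w - M k w + c) ^+ 2) / n%:R @[n --> \oo] --> G p + c ^+ 2}.
Proof.
pose K := (2 * G p + 4 * c ^+ 2) * (2 ^+ p * (p%:R * (sigma ^+ 2 * h + gamma ^+ 2 * h
  `^ (2 * H)))).
apply: (@strong_law _ _ _ _ (fun k w => (M (k + p)%N w - M k w + c) ^+ 2) _ K) => [k
  w|n]; first exact: sqr_ge0.
have [a ha ab] := @sqr_increments_variance _ _ _ _ _ _ mixed_gauss_increments
  mixed_process_variogram p (fun j k => mixed_variogram_convex j k p) c (n ^ 4)%N.
exists a => //; apply: (le_trans ab).
rewrite (_ : K * _ = (2 * G p + 4 * c ^+ 2) * (2 ^+ p * (p%:R *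
  ((sigma ^+ 2 * h + gamma ^+ 2 * h `^ (2 * H)) * n%:R ^+ 6)))); last by rewrite /K
    !mulrA.
apply: ler_wpM2l.
  have G0 : 0 <= G p.
    by apply: addr_ge0; apply: mulr_ge0; rewrite ?sqr_ge0 ?powR_ge0// mulr_ge0// ltW.
  by apply: addr_ge0; apply: mulr_ge0 => //; exact: sqr_ge0.
by rewrite !ler_wpM2l// mixed_variogram_fourth_power.
Qed.

End MixedProcess.

(** * Statistics of a path *)

Unset Implicit Arguments.

Section Averages.
Context {R : realType}.
Implicit Types (u v : nat -> R) (a b l : R).

Definition mean_cvg u l : Prop :=
  (\sum_(k < n) u k) / n%:R @[n --> \oo] --> l.

Lemma eq_mean_cvg {u v a b} : u =1 v -> a = b -> mean_cvg u a -> mean_cvg v b.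
Proof. by move=> /funext -> ->. Qed.

Lemma mean_cvgD {u v a b} : mean_cvg u a -> mean_cvg v b ->
  mean_cvg (fun k => u k + v k) (a + b).
Proof.
move=> ua vb; rewrite /mean_cvg.
under eq_fun do rewrite big_split mulrDl.
exact: cvgD.
Qed.

Lemma mean_cvgZ c {u a} : mean_cvg u a -> mean_cvg (fun k => c * u k) (c * a).
Proof.
move=> ua; rewrite /mean_cvg.
under eq_fun do rewrite -mulr_sumr -mulrA.
by apply: cvgM => //; exact: cvg_cst.
Qed.

Lemma mean_cvg_cst c : mean_cvg (fun=> c) c.
Proof.
apply: (cvg_near_cst _) => /=; exists 1%N => // n /= n0.
by rewrite sumr_const card_ord -(mulr_natr c) mulfK// pnatr_eq0 -lt0n.
Qed.

Lemma mean_cvg_shift1 {u l} : mean_cvg u l -> mean_cvg (fun k => u k.+1) l.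
Proof.
move=> ul; rewrite /mean_cvg -cvg_shiftS.
have inv0 : (n.+1%:R : R)^-1 @[n --> \oo] --> (0 : R) by exact: cvg_harmonic.
have ul2 : (\sum_(k < n.+2) u k) / n.+2%:R @[n --> \oo] --> l.
  move: ul; rewrite /mean_cvg -(cvg_shiftn 2).
  by under eq_fun do rewrite /= addn2.
have q1 : (1 + n.+1%:R^-1 : R) @[n --> \oo] --> (1 : R).
  by rewrite -[X in _ --> X]addr0; apply: cvgD => //; exact: cvg_cst.
(* Dropping the first term changes the normalization by (n+2)/(n+1) = 1 + 1/(n+1). *)
rewrite [X in X @ _](_ : _ = (fun n => (\sum_(k < n.+2) u k) / n.+2%:R * (1 +
  n.+1%:R^-1) -
    u 0%N * n.+1%:R^-1)).
  rewrite -[l]subr0 -[X in X - _]mulr1 -[X in _ - X](mulr0 (u 0%N)).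
  by apply: cvgB; apply: cvgM => //; exact: cvg_cst.
apply/funext => n /=; rewrite (big_ord_recl n.+1)/=.
rewrite -[n.+2%:R]natr1.
have : n.+1%:R != 0 :> R by rewrite pnatr_eq0.
have : n.+1%:R + 1 != 0 :> R by rewrite natr1 pnatr_eq0.
move: n.+1%:R (\sum_(i < n.+1) _) => x s x1 x0.
by field; rewrite x0 x1.
Qed.

Lemma mean_cvg_shift s {u l} : mean_cvg u l -> mean_cvg (fun k => u (k + s)%N) l.
Proof.
move=> ul; elim: s => [|s IH]; first by apply: (eq_mean_cvg _ _ ul) => // k; rewrite
  addn0.
by apply: (eq_mean_cvg _ _ (mean_cvg_shift1 IH)) => // k; rewrite addnS.
Qed.

End Averages.

Section PathStatistics.
Context (R : realType) (sigma gamma H h theta : R) (y : R -> R) (m : nat -> R).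
Hypothesis h0 : 0 < h.
Hypothesis ym : forall k, y (k%:R * h) = theta * (k%:R * h) + m k.
Local Notation G := (mixed_variogram sigma gamma H h).
Hypothesis avg : forall p c : nat,
  mean_cvg (fun k => (m (k + p)%N - m k + c%:R) ^+ 2) (G p + c%:R ^+ 2).

(** Here the shift c pays off: (D + 1)^2 - D^2 - 1 = 2D. *)
Let avg1 p : mean_cvg (fun k => m (k + p)%N - m k) 0.
Proof.
apply: (eq_mean_cvg _ _ (mean_cvgZ 2^-1 (mean_cvgD (mean_cvgD (avg p 1) (mean_cvgZ
  (-1) (avg p 0)))
  (mean_cvg_cst (-1))))) => [k|]; by field.
Qed.

Let Q (p : nat) := theta ^+ 2 * p%:R ^+ 2 * h ^+ 2 + G p.

Let incr_p (p k : nat) := y ((k + p)%:R * h) - y (k%:R * h).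

Let incr_pE p k : incr_p p k = theta * p%:R * h + (m (k + p)%N - m k).
Proof. by rewrite /incr_p !ym natrD; ring. Qed.

Let avg_incr_sqr p : mean_cvg (fun k => incr_p p k ^+ 2) (Q p).
Proof.
apply: (eq_mean_cvg _ _ (mean_cvgD (mean_cvgD (mean_cvg_cst (theta ^+ 2 * p%:R ^+ 2 *
  h ^+ 2))
  (mean_cvgZ (2 * theta * p%:R * h) (avg1 p))) (avg p 0))) => [k|].
  by rewrite incr_pE; ring.
by rewrite /Q; ring.
Qed.

(** Two adjacent lag-p increments add up to a lag-2p increment, so their product is half of its
    square minus the two squares. *)
Let avg_incr_prod p : mean_cvg (fun k => incr_p p k * incr_p p (k + p)%N)
  ((Q (p + p)%N - 2 * Q p) / 2).
Proof.
apply: (eq_mean_cvg _ _ (mean_cvgZ 2^-1 (mean_cvgD (avg_incr_sqr (p + p)) (mean_cvgZ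
  (-1)
  (mean_cvgD (avg_incr_sqr p) (mean_cvg_shift p (avg_incr_sqr p))))))) => [k|]; last
    by field.
by rewrite /incr_p !addnA; field.
Qed.

Lemma theta_hat_cvg : theta_hat h y n @[n --> \oo] --> theta.
Proof.
have hl : mean_cvg (fun k => h^-1 * incr h y k) theta.
  apply: (eq_mean_cvg _ _ (mean_cvgZ h^-1 (mean_cvgD (mean_cvg_cst (theta * h)) (avg1
    1)))) => [k|].
    by rewrite /incr !ym addn1 -natr1; congr (_ * _); ring.
  by field; rewrite gt_eqF.
rewrite [X in X @ _](_ : _ = (fun n => (\sum_(k < n) h^-1 * incr h y k) / n%:R))//.
apply/funext => n; rewrite /theta_hat -mulr_sumr invfM; ring.
Qed.

Lemma xi_stat_cvg : xi_stat h y n @[n --> \oo] -->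
  theta ^+ 2 * h ^+ 2 + sigma ^+ 2 * h + gamma ^+ 2 * h `^ (2 * H).
Proof.
have := avg_incr_sqr 1; rewrite /mean_cvg.
have -> : (fun n => (\sum_(k < n) incr_p 1 k ^+ 2) / n%:R) = xi_stat h y.
  apply/funext => n; rewrite /xi_stat mulrC; congr (_ * _).
  by apply: eq_bigr => k _; rewrite /incr_p addn1.
by rewrite /Q /mixed_variogram expr1n mulr1 mul1r addrA.
Qed.

Lemma eta_stat_cvg : eta_stat h y n @[n --> \oo] -->
  theta ^+ 2 * h ^+ 2 + gamma ^+ 2 * h `^ (2 * H) * (2 `^ (2 * H - 1) - 1).
Proof.
have := avg_incr_prod 1; rewrite /mean_cvg.
have -> : (fun n => (\sum_(k < n) incr_p 1 k * incr_p 1 (k + 1)%N) / n%:R) = eta_stat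
  h y.
  apply/funext => n; rewrite /eta_stat mulrC; congr (_ * _).
  by apply: eq_bigr => k _; rewrite /incr_p !addn1.
have -> : (Q (1 + 1) - 2 * Q 1) / 2 = theta ^+ 2 * h ^+ 2 + gamma ^+ 2 * h `^ (2 * H)
  * (2 `^ (2 * H - 1) - 1).
  rewrite /Q /mixed_variogram !mul1r powRM ?(ltW h0)//.
  rewrite powRB ?pnatr_eq0 ?implybT// powRr1//.
  by field.
by [].
Qed.

Lemma zeta_stat_cvg : zeta_stat h y n @[n --> \oo] -->
  4 * theta ^+ 2 * h ^+ 2 + gamma ^+ 2 * h `^ (2 * H) * 2 `^ (2 * H) * (2 `^ (2 * H -
    1) - 1).
Proof.
have := avg_incr_prod 2; rewrite /mean_cvg.
have -> : (fun n => (\sum_(k < n) incr_p 2 k * incr_p 2 (k + 2)%N) / n%:R) =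
  zeta_stat h y.
  apply/funext => n; rewrite /zeta_stat mulrC; congr (_ * _).
  by apply: eq_bigr => k _; rewrite /incr_p !addn2.
have -> : (Q (2 + 2) - 2 * Q 2) / 2 = 4 * theta ^+ 2 * h ^+ 2 +
    gamma ^+ 2 * h `^ (2 * H) * 2 `^ (2 * H) * (2 `^ (2 * H - 1) - 1).
  rewrite /Q /mixed_variogram.
  have -> : (2 + 2)%N%:R = 2 * 2 :> R by rewrite -natrM.
  rewrite !powRM ?(ltW h0) ?mulr_ge0//.
  rewrite powRB ?pnatr_eq0 ?implybT// powRr1//.
  by field.
by [].
Qed.

End PathStatistics.

Set Implicit Arguments.

(** * The estimator of sigma^2 *)

(** Rewriting through a real power of x^2 settles both signs at once; at 0 the factor x reproduces
    the convention 0^-1 = 0. *)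
Lemma measurable_invr (R : realType) : measurable_fun [set: R] (fun x : R => x^-1).
Proof.
rewrite (_ : (fun x => x^-1) = (fun x => x * (x ^+ 2) `^ (-1))).
  apply: measurable_funM => //.
  apply: (@measurableT_comp _ _ _ _ _ _ (@powR R ^~ (-1)) _ (fun x : R => x ^+ 2)).
    exact: measurable_powR.
  exact: measurable_funX.
apply/funext => x; rewrite powR_inv1 ?sqr_ge0//.
have [->|x0] := eqVneq x 0; first by rewrite invr0 mul0r.
by field.
Qed.

Lemma powR2_log2p (R : realType) (x : R) : 2 `^ log2p x = if 0 < x then x else 1.
Proof.
rewrite /log2p; case: ifP => x0; last by rewrite powRr0.
rewrite /powR pnatr_eq0/= divfK ?lnK//.
by rewrite gt_eqF// ln_gt0// ltr1n.
Qed.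

Section Estimator.
Context (R : realType) (h : R).
Hypothesis h0 : 0 < h.

Definition sigma2_core (a b x : R) : R :=
  (a - b / ((if 0 < x then x else 1) / 2 - 1)) / h.

(* The power h^(2 hatH) of [gamma2_fun] cancels and 2^(2 hatH) is the argument
   of the logarithm, or 1 when that argument is not positive. *)
Lemma sigma2_funE V xi eta zeta : sigma2_fun h V xi eta zeta =
  sigma2_core (xi - h ^+ 2 * V) (eta - h ^+ 2 * V)
    ((zeta - 4 * h ^+ 2 * V) / (eta - h ^+ 2 * V)).
Proof.
rewrite /sigma2_fun /gamma2_fun /sigma2_core /H_fun.
set x := (zeta - 4 * h ^+ 2 * V) / (eta - h ^+ 2 * V).
have -> : 2 `^ (2 * (log2p x / 2) - 1) = (if 0 < x then x else 1) / 2.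
  rewrite mulrC divfK ?pnatr_eq0// powRB ?pnatr_eq0 ?implybT// powRr1//.
  by rewrite powR2_log2p.
have hH : h `^ (2 * (log2p x / 2)) != 0 by rewrite gt_eqF// powR_gt0.
move: (h `^ _) hH => z z0; move: (_ / 2 - 1) => t.
by congr ((_ - _) / _); rewrite invfM mulrA mulrAC divfK.
Qed.

(** The condition 2b < c says that the ratio c / b, the estimate of 2^(2H), exceeds 2, that is H >
    1/2. There the estimator is a rational function without conditionals. *)
Lemma sigma2_core_rational a b c : 0 < b -> 2 * b < c ->
  sigma2_core a b (c / b) = (a - 2 * b ^+ 2 / (c - 2 * b)) / h.
Proof.
move=> b0 bc; have c0 : 0 < c by lra.
rewrite /sigma2_core divr_gt0//; congr ((_ - _) / _).
by field; rewrite !gt_eqF//=; lra.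
Qed.

(** Each partial derivative is a derivative along a line in the space of contrasts, so one
    computation with direction (a', b', c') serves all four. The rational form holds only near [x0],
    which is enough for a derivative. *)
Lemma is_derive_sigma2_core_line (a b c a' b' c' x0 : R) : 0 < b -> 2 * b < c ->
  is_derive x0 (1 : R) (fun x => sigma2_core (a + a' * (x - x0)) (b + b' * (x - x0))
    ((c + c' * (x - x0)) / (b + b' * (x - x0))))
    (a' * h^-1 - b' * ((4 * b * (c - 2 * b) + 4 * b ^+ 2) / (c - 2 * b) ^+ 2 / h)
     + c' * (2 * b ^+ 2 / (c - 2 * b) ^+ 2 / h)).
Proof.
move=> b0 bc.
pose q (x : R) := (a + a' * (x - x0) - 2 * (b + b' * (x - x0)) ^+ 2 /
  (c + c' * (x - x0) - 2 * (b + b' * (x - x0)))) / h.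
have aff (u u' : R) : u + u' * (x - x0) @[x --> x0] --> u.
  have -> : nbhs u = nbhs (u + u' * (x0 - x0)) by rewrite subrr mulr0 addr0.
  apply: cvgD; first exact: cvg_cst.
  apply: cvgM; first exact: cvg_cst.
  by apply: cvgB; [exact: cvg_id|exact: cvg_cst].
have cbx : \forall x \near x0, 2 * (b + b' * (x - x0)) < c + c' * (x - x0).
  have h1 : c + c' * (x - x0) - 2 * (b + b' * (x - x0)) @[x --> x0] --> c - 2 * b.
    by apply: cvgB => //; apply: cvgM => //; exact: cvg_cst.
  have cb0 : 0 < c - 2 * b by rewrite subr_gt0.
  have : \forall x \near x0, 0 < c + c' * (x - x0) - 2 * (b + b' * (x - x0)).
    by apply: (cvgr_gt _ h1 _ cb0).
  by apply: filterS => x; rewrite subr_gt0.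
have bx : \forall x \near x0, 0 < b + b' * (x - x0) by apply: (cvgr_gt _ (aff b b') _
  b0).
apply: (@near_eq_is_derive _ _ _ q).
  by apply: filterS2 bx cbx => x b1 c1; rewrite sigma2_core_rational.
have d0 : c + c' * (x0 - x0) - 2 * (b + b' * (x0 - x0)) != 0.
  by rewrite subrr !mulr0 !addr0 gt_eqF// subr_gt0.
rewrite /q.
have dA (u u' : R) : is_derive x0 (1:R) (fun x => u + u' * (x - x0)) u'.
  by apply: is_derive_eq; rewrite /GRing.scale/=; ring.
have dN := is_deriveZ 2 (@is_deriveX _ _ _ 2 _ _ _ (dA b b')).
have dD := is_deriveB (dA c c') (is_deriveZ 2 (dA b b')).
have dV := @is_deriveV _ (fun x => c + c' * (x - x0) - 2 * (b + b' * (x - x0))) _ _ _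
  d0 dD.
have dq := is_deriveZ h^-1 (is_deriveB (dA a a') (is_deriveM dN dV)).
have -> : (fun x => (a + a' * (x - x0) - 2 * (b + b' * (x - x0)) ^+ 2 /
    (c + c' * (x - x0) - 2 * (b + b' * (x - x0)))) / h) =
  h^-1 \*: ((fun x => a + a' * (x - x0)) - 2 \*: ((fun x => b + b' * (x - x0)) ^+ 2) *
   (fun y => (c + c' * (y - x0) - 2 * (b + b' * (y - x0)))^-1)).
  by apply/funext => x /=; rewrite mulrC.
apply: (@is_derive_eq _ _ _ _ _ _ _ _ dq).
rewrite /GRing.scale/= /GRing.scale/= exprfctE subrr !mulr0 !addr0 expr1.
have cb : c - 2 * b != 0 by rewrite gt_eqF// subr_gt0.
have hn0 : h != 0 by rewrite gt_eqF.
by field; rewrite cb hn0.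
Qed.

Lemma derive1_sigma2_core_line (f : R -> R) (x0 a b c a' b' c' : R) :
  0 < b -> 2 * b < c ->
  (forall x, f x = sigma2_core (a + a' * (x - x0)) (b + b' * (x - x0))
    ((c + c' * (x - x0)) / (b + b' * (x - x0)))) ->
  f^`()%classic x0 = a' * h^-1
     - b' * ((4 * b * (c - 2 * b) + 4 * b ^+ 2) / (c - 2 * b) ^+ 2 / h)
     + c' * (2 * b ^+ 2 / (c - 2 * b) ^+ 2 / h).
Proof.
move=> b0 bc /funext ->; rewrite derive1E.
have D := is_derive_sigma2_core_line a a' b' c' x0 b0 bc.
exact: derive_val.
Qed.

(** Moving V shifts the contrasts by (-h^2, -h^2, -4h^2), while xi, eta and zeta shift one contrast
    each by 1; with weights (1, h^2, h^2, 4h^2) the shifts cancel. *)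
Lemma sigma2_gradient_dot V xi eta zeta :
  0 < eta - h ^+ 2 * V -> 2 * (eta - h ^+ 2 * V) < zeta - 4 * h ^+ 2 * V ->
  sigma2_gradient h V xi eta zeta *m
    (\col_(j < 4) [:: 1; h ^+ 2; h ^+ 2; 4 * h ^+ 2]`_j) = 0.
Proof.
set a := xi - h ^+ 2 * V; set b := eta - _; set c := zeta - _ => b0 bc.
apply/matrixP => i j; rewrite !mxE !big_ord_recl big_ord0 !mxE/=.
rewrite (@derive1_sigma2_core_line _ V a b c (- h ^+ 2) (- h ^+ 2) (- (4 * h ^+ 2))
  b0 bc); last first.
  by move=> x; rewrite sigma2_funE; congr (sigma2_core _ _ (_ / _)); rewrite /a /b
    /c; ring.
rewrite (@derive1_sigma2_core_line _ xi a b c 1 0 0 b0 bc); last first.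
  by move=> x; rewrite sigma2_funE; congr (sigma2_core _ _ (_ / _)); rewrite /a /b
    /c; ring.
rewrite (@derive1_sigma2_core_line _ eta a b c 0 1 0 b0 bc); last first.
  by move=> x; rewrite sigma2_funE; congr (sigma2_core _ _ (_ / _)); rewrite /a /b
    /c; ring.
rewrite (@derive1_sigma2_core_line _ zeta a b c 0 0 1 b0 bc); last first.
  by move=> x; rewrite sigma2_funE; congr (sigma2_core _ _ (_ / _)); rewrite /a /b
    /c; ring.
by ring.
Qed.

Lemma sigma2_fun_cvg (V xi eta zeta : nat -> R) (a b c : R) : 0 < b -> 2 * b < c ->
  xi n - h ^+ 2 * V n @[n --> \oo] --> a ->
  eta n - h ^+ 2 * V n @[n --> \oo] --> b ->
  zeta n - 4 * h ^+ 2 * V n @[n --> \oo] --> c ->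
  sigma2_fun h (V n) (xi n) (eta n) (zeta n) @[n --> \oo] -->
    (a - 2 * b ^+ 2 / (c - 2 * b)) / h.
Proof.
move=> b0 bc av bv cv.
have cbv : (zeta n - 4 * h ^+ 2 * V n) - 2 * (eta n - h ^+ 2 * V n) @[n --> \oo] -->
  c - 2 * b.
  by apply: cvgB => //; apply: cvgM => //; exact: cvg_cst.
have cb0 : 0 < c - 2 * b by rewrite subr_gt0.
have b_near : \forall n \near \oo, 0 < eta n - h ^+ 2 * V n by apply: (cvgr_gt _ bv _
  b0).
have c_near : \forall n \near \oo, 0 < zeta n - 4 * h ^+ 2 * V n - 2 * (eta n - h ^+
  2 * V n).
  by apply: (cvgr_gt _ cbv _ cb0).
pose q n := ((xi n - h ^+ 2 * V n) - 2 * (eta n - h ^+ 2 * V n) ^+ 2 /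
  ((zeta n - 4 * h ^+ 2 * V n) - 2 * (eta n - h ^+ 2 * V n))) / h.
have qv : q n @[n --> \oo] --> (a - 2 * b ^+ 2 / (c - 2 * b)) / h.
  apply: cvgM; last exact: cvg_cst.
  apply: cvgB => //; apply: cvgM; last first.
    by apply: cvgV => //; rewrite gt_eqF.
  apply: cvgM; first exact: cvg_cst.
  exact: (cvg_comp _ _ bv (@exprn_continuous R 2 b)).
apply: cvg_trans qv; apply: near_eq_cvg.
apply: filterS2 b_near c_near => n bn cn.
by rewrite sigma2_funE sigma2_core_rational// -subr_gt0.
Qed.

End Estimator.

(** * Convergence in law to a point mass *)

Section Law.
Context (R : realType) d (T : measurableType d) (P : probability T R).

(** For each fixed N the intermediate law is already the Dirac mass, by bounded convergence, so the
    limit in N is that of a constant sequence. *)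
Lemma seq_cvg_law_gauss00 N0 (X : nat -> nat -> T -> R) :
  (forall n N, measurable_fun [set: T] (X n N)) ->
  (forall N, (N0 <= N)%N -> {ae P, forall w, X n N w @[n --> \oo] --> 0}) ->
  seq_cvg_law P N0 X (gauss 0 0).
Proof.
move=> mX X0; exists (fun=> gauss 0 0); split; last by move=> f _; exact: cvg_cst.
move=> N N0N f [cf [C fC]].
have mf : measurable_fun [set: R] f by exact: continuous_measurable_fun.
rewrite /gauss eqxx integral_dirac//; last exact/measurable_EFinP.
rewrite diracT mul1e.
have mfX n : measurable_fun [set: T] (fun w => (f (X n N w))%:E).
  by apply/measurable_EFinP; exact: measurableT_comp.
have cfX : {ae P, forall w, setT w -> ((f (X n N w))%:E @[n --> \oo] --> ((f 0)%:E))}.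
  apply: filterS (X0 _ N0N) => w Xw _; apply: cvg_EFin; first exact: nearW.
  exact: (cvg_comp _ _ Xw (cf 0)).
have iC : P.-integrable [set: T] (fun=> C%:E) by exact: finite_measure_integrable_cst.
have bfX : {ae P, forall w n, setT w -> (`|(f (X n N w))%:E| <= C%:E)%E}.
  by apply: aeW => w n _; rewrite lee_fin.
have [_ _] := @dominated_convergence _ T R P _ measurableT _ _ _ mfX
  (measurable_cst _) cfX iC bfX.
have [_ ->] := has_integral_cst P (f 0).
exact.
Qed.

End Law.

(** * Measurability of the statistics and estimators *)

Section Measurability.
Context (R : realType) d (T : measurableType d).
Variables (h : R) (h0 : 0 < h) (Y : T -> nat -> R -> R).
Hypothesis mY : forall i t, measurable_fun [set: T] (fun w => Y w i t).

Lemma measurable_theta_hat i n : measurable_fun [set: T] (fun w => theta_hat h (Y w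
  i) n).
Proof.
apply: measurable_funM => //; apply: measurable_sum => k.
exact: measurable_funB.
Qed.

Lemma measurable_xi_stat i n : measurable_fun [set: T] (fun w => xi_stat h (Y w i) n).
Proof.
apply: measurable_funM => //; apply: measurable_sum => k.
by apply: measurable_funX; exact: measurable_funB.
Qed.

Lemma measurable_eta_stat i n : measurable_fun [set: T] (fun w => eta_stat h (Y w i) n).
Proof.
apply: measurable_funM => //; apply: measurable_sum => k.
by apply: measurable_funM; exact: measurable_funB.
Qed.

Lemma measurable_zeta_stat i n : measurable_fun [set: T] (fun w => zeta_stat h (Y w
  i) n).
Proof.
apply: measurable_funM => //; apply: measurable_sum => k.
by apply: measurable_funM; exact: measurable_funB.
Qed.

Lemma measurable_average N (F : T -> nat -> R) :
  (forall i, measurable_fun [set: T] (fun w => F w i)) ->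
  measurable_fun [set: T] (fun w => average N (F w)).
Proof. by move=> mF; apply: measurable_funM => //; exact: measurable_sum. Qed.

Lemma measurable_sigma2_hat n N : measurable_fun [set: T] (fun w => sigma2_hat h (Y
  w) n N).
Proof.
have mV : measurable_fun [set: T] (fun w => average N (fun i => theta_hat h (Y w i) n
  ^+ 2)).
  by apply: measurable_average => i; apply: measurable_funX; exact:
    measurable_theta_hat.
have mxi : measurable_fun [set: T] (fun w => average N (fun i => xi_stat h (Y w i) n)).
  by apply: measurable_average => i; exact: measurable_xi_stat.
have meta : measurable_fun [set: T] (fun w => average N (fun i => eta_stat h (Y w i)
  n)).
  by apply: measurable_average => i; exact: measurable_eta_stat.
have mzeta : measurable_fun [set: T] (fun w => average N (fun i => zeta_stat h (Y w
  i) n)).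
  by apply: measurable_average => i; exact: measurable_zeta_stat.
have mb : measurable_fun [set: T] (fun w => average N (fun i => eta_stat h (Y w i) n) -
    h ^+ 2 * average N (fun i => theta_hat h (Y w i) n ^+ 2)).
  by apply: measurable_funB => //; exact: measurable_funM.
have mx : measurable_fun [set: T] (fun w => (average N (fun i => zeta_stat h (Y w i)
  n) -
    4 * h ^+ 2 * average N (fun i => theta_hat h (Y w i) n ^+ 2)) /
    (average N (fun i => eta_stat h (Y w i) n) -
    h ^+ 2 * average N (fun i => theta_hat h (Y w i) n ^+ 2))).
  apply: measurable_funM; last exact: (measurableT_comp (@measurable_invr R) mb).
  by apply: measurable_funB => //; exact: measurable_funM.
rewrite /sigma2_hat; under eq_fun do rewrite sigma2_funE//.
apply: measurable_funM => //; apply: measurable_funB.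
  by apply: measurable_funB => //; exact: measurable_funM.
apply: measurable_funM => //.
apply: (measurableT_comp (@measurable_invr R)).
apply: measurable_funB => //; apply: measurable_funM => //.
by apply: measurable_fun_ifT => //; exact: measurable_fun_ltr.
Qed.

Lemma measurable_phi_hat i n N : measurable_fun [set: T] (fun w => phi_hat h (Y w) i
  n N).
Proof.
apply: measurable_funD; first exact: measurable_theta_hat.
by apply: measurable_funM => //; exact: measurable_sigma2_hat.
Qed.

End Measurability.

(** * Limits for a fixed number of subjects *)

Lemma average_cvg (R : realType) N (F : nat -> nat -> R) (l : nat -> R) :
  (forall i, F n i @[n --> \oo] --> l i) ->
  average N (F n) @[n --> \oo] --> average N l.
Proof.
move=> Fl; apply: cvgM; first exact: cvg_cst.
by apply: cvg_big => [|i _]; [exact: add_continuous|exact: Fl].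
Qed.

Lemma average_affine (R : realType) N (x : nat -> R) (a b : R) : (0 < N)%N ->
  average N (fun i => a * x i + b) = a * average N x + b.
Proof.
move=> N0; rewrite /average big_split/= -mulr_sumr sumr_const card_ord -(mulr_natr b).
have : N%:R != 0 :> R by rewrite pnatr_eq0 -lt0n.
by move: N%:R (\sum_(i < N) x i) => n s n0; field.
Qed.

Lemma powR2_subr1_gt0 (R : realType) (H : R) : 1 / 2 < H -> 0 < 2 `^ (2 * H - 1) - 1.
Proof.
move=> H_gt; rewrite subr_gt0 -[ltLHS](powRr0 2) /powR pnatr_eq0/= ltr_expR mul0r.
by rewrite mulr_gt0// ?ln_gt0 ?ltr1n//; lra.
Qed.

(** Expresses 2^(2H) through t = 2^(2H-1) - 1, so that later goals are rational in t and g = gamma^2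
    h^(2H). *)
Lemma powR2_double (R : realType) (H : R) :
  2 `^ (2 * H) = 2 * ((2 `^ (2 * H - 1) - 1) + 1).
Proof.
rewrite subrK powRB ?pnatr_eq0 ?implybT// powRr1//.
by field.
Qed.

(* [sigma2_fun] depends on the statistics only through [xi - h^2 V],
   [eta - h^2 V] and [zeta - 4 h^2 V], so its derivative vanishes along
   (1, h^2, h^2, 4h^2), the range of the covariance matrix. *)
Lemma asymptotic_variance_sigma2_eq0 (R : realType) (sigma gamma H h m v : R) :
  0 < h -> gamma != 0 -> 1 / 2 < H ->
  asymptotic_variance_sigma2 sigma gamma H h m v = 0.
Proof.
move=> h0 gamma0 H_gt; rewrite /asymptotic_variance_sigma2.
have g0 : 0 < gamma ^+ 2 * h `^ (2 * H).
  by rewrite mulr_gt0 ?powR_gt0// exprn_even_gt0.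
have t0 := powR2_subr1_gt0 H_gt; rewrite powR2_double.
move: (gamma ^+ 2 * _) g0 (2 `^ _ - 1) t0 => g g0 t t0.
rewrite -scalemxAr mulmxA sigma2_gradient_dot ?mul0mx ?scaler0 ?mul0mx ?mxE//.
- rewrite (_ : _ - _ = g * t); last by ring.
  exact: mulr_gt0.
- rewrite -subr_gt0 [ltRHS](_ : _ = 2 * g * t * t); last by ring.
  exact: (mulr_gt0 (mulr_gt0 (mulr_gt0 (ltr0n _ 2) g0) t0) t0).
Qed.

Lemma sigma2_hat_cvg (R : realType) (sigma gamma H h : R) (theta : nat -> R)
    (y : nat -> R -> R) N : (0 < N)%N -> 0 < h -> gamma != 0 -> 1 / 2 < H ->
  (forall i, theta_hat h (y i) n @[n --> \oo] --> theta i) ->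
  (forall i, xi_stat h (y i) n @[n --> \oo] -->
     theta i ^+ 2 * h ^+ 2 + sigma ^+ 2 * h + gamma ^+ 2 * h `^ (2 * H)) ->
  (forall i, eta_stat h (y i) n @[n --> \oo] -->
     theta i ^+ 2 * h ^+ 2 + gamma ^+ 2 * h `^ (2 * H) * (2 `^ (2 * H - 1) - 1)) ->
  (forall i, zeta_stat h (y i) n @[n --> \oo] -->
     4 * theta i ^+ 2 * h ^+ 2 +
       gamma ^+ 2 * h `^ (2 * H) * 2 `^ (2 * H) * (2 `^ (2 * H - 1) - 1)) ->
  sigma2_hat h y n N @[n --> \oo] --> sigma ^+ 2.
Proof.
move=> N0 h0 gamma0 H_gt th xi eta zeta.
set V := average N (fun i => theta i ^+ 2).
have Vn : average N (fun i => theta_hat h (y i) n ^+ 2) @[n --> \oo] --> V.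
  apply: (@average_cvg _ N (fun n i => theta_hat h (y i) n ^+ 2)) => i.
  exact: (cvg_comp _ _ (th i) (@exprn_continuous R 2 _)).
set g := gamma ^+ 2 * h `^ (2 * H) in xi.
have g0 : 0 < g by rewrite mulr_gt0 ?powR_gt0// exprn_even_gt0.
have t0 := powR2_subr1_gt0 H_gt; have p2 := powR2_double H.
set t := 2 `^ (2 * H - 1) - 1 in eta zeta t0 p2 *.
(* Each statistic has a limit affine in theta_i^2; subtracting [a] times the average of the squared
   drift estimates leaves the constant [b], free of the drifts and of N. *)
have cA (u : nat -> nat -> R) a b : (forall i, u n i @[n --> \oo] --> a * theta i ^+
  2 + b) ->
    average N (u n) - a * average N (fun i => theta_hat h (y i) n ^+ 2) @[n --> \oo]
      --> b.
  move=> ul; have -> : b = average N (fun i => a * theta i ^+ 2 + b) - a * V.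
    by rewrite average_affine// addrC addKr.
  apply: cvgB; first exact: average_cvg.
  by apply: cvgM => //; exact: cvg_cst.
(* With b = gt and c = 2g(t+1)t one has c - 2b = 2gt^2, so the quotient is exactly g. Positivity of
   t, from H > 1/2, keeps the denominator nonzero. *)
have -> : sigma ^+ 2 = ((sigma ^+ 2 * h + g) - 2 * (g * t) ^+ 2 /
    (g * (2 * (t + 1)) * t - 2 * (g * t))) / h.
  have d0 : g * (2 * (t + 1)) * t - 2 * (g * t) != 0.
    rewrite (_ : _ - _ = 2 * g * t * t); last by ring.
    exact/lt0r_neq0/(mulr_gt0 (mulr_gt0 (mulr_gt0 (ltr0n _ 2) g0) t0) t0).
  by field; rewrite d0 gt_eqF.
apply: sigma2_fun_cvg => //.
- exact: mulr_gt0.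
- rewrite -subr_gt0 (_ : _ - _ = 2 * g * t * t); last by ring.
  exact: (mulr_gt0 (mulr_gt0 (mulr_gt0 (ltr0n _ 2) g0) t0) t0).
- by apply: cA => i; have := xi i; rewrite -addrA [_ * h ^+ 2]mulrC.
- by apply: cA => i; have := eta i; rewrite -/t -/g [_ * h ^+ 2]mulrC.
- by apply: cA => i; have := zeta i; rewrite -/t -/g p2 mulrAC.
Qed.



Unset Implicit Arguments.

Theorem proposition5 (R : realType) (d : measure_display) (T : measurableType d)
    (P : probability T R) (sigma gamma H h : R)
    (B BH : nat -> R -> {RV P >-> R}) (phi : nat -> {RV P >-> R})
    (sigma_gt0 : 0 < sigma) (gamma_gt0 : 0 < gamma) (h_gt0 : 0 < h)
    (H_gt : 1 / 2 < H) (H_lt : H < 3 / 4)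
    (B_bm : forall i, standard_brownian (B i))
    (BH_fbm : forall i, fractional_brownian H (BH i))
    (B_BH_indep : mutually_independent P
       (fun ib : nat * bool =>
          sigma_gen [set t : R | 0 <= t]
            (fun t => (if ib.2 then B ib.1 t else BH ib.1 t) : T -> R)))
    (phi_iid : iid phi)
    (phi_M_indep :
       let M := mixed_fbm sigma gamma (fun i t => B i t : T -> R)
                                      (fun i t => BH i t : T -> R) in
       independent2 P
         (sigma_gen [set: nat] (fun i => phi i : T -> R))
         (sigma_gen [set it : nat * R | 0 <= it.2] (fun it => M it.1 it.2)))
    (phi_moment4 : forall i, ('E_P[(fun w => (phi i w ^+ 4)%R)] < +oo)%E) :
  let M := mixed_fbm sigma gamma (fun i t => B i t : T -> R)
                                 (fun i t => BH i t : T -> R) in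
  let theta := drift sigma (fun i => phi i : T -> R) in
  let Y := log_process theta M in
  let v_sigma2 := asymptotic_variance_sigma2 sigma gamma H h
                    (fine 'E_P[(fun w => (theta 0%N w ^+ 2)%R)])
                    (fine 'V_P[(fun w => (theta 0%N w ^+ 2)%R)]) in
  (forall i : nat,
     seq_cvg_as P i.+1 (fun n N w => phi_hat h (Y w) i n N) (phi i)) /\
  seq_cvg_law P 1
    (fun n N w => Num.sqrt N%:R * (sigma2_hat h (Y w) n N - sigma ^+ 2))
    (gauss 0 v_sigma2) /\
  (forall i : nat,
     seq_cvg_law P i.+1
       (fun n N w => Num.sqrt N%:R * (phi_hat h (Y w) i n N - phi i w))
       (gauss 0 (v_sigma2 / 4))).
Proof.
move=> M theta Y v_sigma2.
(* A countable intersection over subjects, lags and natural shifts; on this single event the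
   remaining limits are pathwise. *)
have good : {ae P, forall w, forall i p c : nat,
    mean_cvg (fun k => (M i ((k + p)%:R * h) w - M i (k%:R * h) w + c%:R) ^+ 2)
      (mixed_variogram sigma gamma H h p + c%:R ^+ 2)}.
  apply/ae_foralln => i; apply/ae_foralln => p; apply/ae_foralln => c.
  have ind : independent2 P (sigma_gen [set t : R | 0 <= t] (fun t => B i t : T -> R))
      (sigma_gen [set t : R | 0 <= t] (fun t => BH i t : T -> R)).
    move=> A C sA sC.
    (* Independence of [B i] and [BH i] is the product rule for this two-element subfamily. *)
    have uJ : uniq [:: (i, true); (i, false)] by rewrite /= inE xpair_eqE eqxx.
    have := B_BH_indep [:: (i, true); (i, false)] (fun ib => if ib.2 then A else C) uJ.
    rewrite !big_cons big_nil mule1 => <-.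
      congr (P _); apply/seteqP; split => [w [Aw Cw] ib|w AC] /=.
        by rewrite !inE => /orP[] /eqP ->.
      by split; [apply: (AC (i, true))|apply: (AC (i, false))]; rewrite /= !inE eqxx
        ?orbT.
    by move=> ib; rewrite !inE => /orP[] /eqP ->.
  have := mixed_average_cvg sigma gamma h_gt0 H_gt H_lt (B_bm i) (BH_fbm i) ind p c%:R.
  by apply: filterS.
have stats w : (forall i p c : nat,
    mean_cvg (fun k => (M i ((k + p)%:R * h) w - M i (k%:R * h) w + c%:R) ^+ 2)
      (mixed_variogram sigma gamma H h p + c%:R ^+ 2)) ->
    (forall i, theta_hat h (Y w i) n @[n --> \oo] --> theta i w) /\
    (forall N, (0 < N)%N -> sigma2_hat h (Y w) n N @[n --> \oo] --> sigma ^+ 2).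
  move=> gw; have yE i k : Y w i (k%:R * h) = theta i w * (k%:R * h) + M i (k%:R * h)
    w by [].
  have th i := theta_hat_cvg _ _ _ _ _ _ _ _ h_gt0 (yE i) (gw i).
  split=> // N N0; apply: (@sigma2_hat_cvg _ sigma gamma H h (theta ^~ w)) => //.
  - by rewrite gt_eqF.
  - move=> i; exact: (xi_stat_cvg _ _ _ _ _ _ _ _ (yE i) (gw i)).
  - move=> i; exact: (eta_stat_cvg _ _ _ _ _ _ _ _ h_gt0 (yE i) (gw i)).
  - move=> i; exact: (zeta_stat_cvg _ _ _ _ _ _ _ _ h_gt0 (yE i) (gw i)).
have phi_cvg w i N : (0 < N)%N -> (forall i p c : nat,
    mean_cvg (fun k => (M i ((k + p)%:R * h) w - M i (k%:R * h) w + c%:R) ^+ 2)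
      (mixed_variogram sigma gamma H h p + c%:R ^+ 2)) ->
    phi_hat h (Y w) i n N @[n --> \oo] --> phi i w.
  move=> N0 /stats[th s2].
  have -> : phi i w = theta i w + sigma ^+ 2 / 2 by rewrite subrK.
  by apply: cvgD => //; apply: cvgM; [exact: s2|exact: cvg_cst].
have v0 : v_sigma2 = 0 by apply: asymptotic_variance_sigma2_eq0 => //; rewrite gt_eqF.
have mY i t : measurable_fun [set: T] (fun w => Y w i t).
  apply: measurable_funD.
    by apply: measurable_funM => //; exact: measurable_funB.
  by apply: measurable_funD; exact: measurable_funM.
rewrite v0 mul0r; split; [|split].
(* The inner limit in n is [phi i] for every N > i, so the outer sequence is constant. *)
- move=> i; exists (fun=> phi i); split; last by apply: aeW => w; exact: cvg_cst.
  by move=> N iN; apply: filterS good => w; apply: phi_cvg; exact: leq_ltn_trans iN.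
- apply: seq_cvg_law_gauss00 => [n N|N N0].
    apply: measurable_funM => //; apply: measurable_funB => //.
    exact: measurable_sigma2_hat.
  apply: filterS good => w /stats[_ s2]; rewrite -(mulr0 (Num.sqrt N%:R)) -(subrr
    (sigma ^+ 2)).
  by apply: cvgM; [exact: cvg_cst|apply: cvgB; [exact: s2|exact: cvg_cst]].
- move=> i; apply: seq_cvg_law_gauss00 => [n N|N iN].
    apply: measurable_funM => //; apply: measurable_funB => //.
    exact: measurable_phi_hat.
  (* While n tends to infinity the factor sqrt N is a constant, so it multiplies an error that
     vanishes. *)
  apply: filterS good => w gw; rewrite -(mulr0 (Num.sqrt N%:R)) -(subrr (phi i w)).
  apply: cvgM; first exact: cvg_cst.
  by apply: cvgB; [apply: phi_cvg => //; exact: leq_ltn_trans iN|exact: cvg_cst].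
Qed.
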